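(* Let $\theta$ be an inner function and let $G \in L^\infty\setminus\{0\}$. Suppose that some function of the form $f=\theta+f_-$, with $f_- \in H^2_-$, belongs to $\ker (GP^+ + P^-)$. Then $\overline G \in z\theta H^\infty$ and, if $\overline G = \theta z G_i G_o$ with $G_i$ inner and $G_o$ outer (so that $G_iG_o$ is an inner--outer factorization of $\overline{z\theta}\,\overline G$), then \[ P^+ \big(\ker (GP^+ + P^-)\big) = \ker T_G = K_{z\theta G_i}. \]
   Context: $\mathbb T$ is the unit circle, $L^2=L^2(\mathbb T)$, $L^\infty=L^\infty(\mathbb T)$. $H^2_+=H^2(\mathbb D)$ and $H^\infty$ are the Hardy spaces of the unit disc, identified with spaces of boundary functions on $\mathbb T$; $H^2_-=L^2\ominus H^2_+$. $P^+$ and $P^-=I-P^+$ are the orthogonal projections of $L^2$ onto $H^2_+$ and $H^2_-$. For $G\in L^\infty$, the Toeplitz operator is $T_G:H^2_+\to H^2_+$, $T_G f=P^+(Gf)$, and the paired operator $GP^++P^-:L^2\to L^2$ is $f\mapsto G\cdot P^+f+P^-f$. For an inner function $\beta$, $K_\beta=H^2_+\ominus\beta H^2_+$ is the model space. Here $z$ denotes the function $z\mapsto z$ and bars denote complex conjugation on $\mathbb T$. *)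

(* Defs.v *)
From HB Require Import structures.
From mathcomp Require Import all_boot all_order all_algebra.
From mathcomp Require Import complex.
From mathcomp Require Import all_classical all_reals all_analysis.

Set Implicit Arguments.
Unset Strict Implicit.
Unset Printing Implicit Defensive.

Import Order.TTheory GRing.Theory Num.Theory.
Import numFieldNormedType.Exports.

Local Open Scope classical_set_scope.
Local Open Scope complex_scope.
Local Open Scope ring_scope.

(* The real-valued modulus: on R[i], the generic `|z| is valued in R[i]. *)
Definition cabs (R : realType) (z : R[i]) : R := ComplexField.Normc.normc z.

Definition cexp (R : realType) (z : R[i]) : R[i] :=
  (expR (complex.Re z))%:C * (cos (complex.Im z) +i* sin (complex.Im z)).

Definition circle (R : realType) : Type := {z : R[i] | cabs z == 1}.

Lemma cabs_cos_sin (R : realType) (t : R) : cabs (cos t +i* sin t) == 1.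
Proof. by rewrite /cabs /= cos2Dsin2 sqrtr1. Qed.

Definition circ (R : realType) (t : R) : circle R :=
  exist (fun z : R[i] => is_true (cabs z == 1)) _ (cabs_cos_sin t).

Section CircleFunctions.
Context {R : realType}.
Local Notation C := R[i].
Local Notation T := (circle R).
Local Notation mu := (@lebesgue_measure R).

(* The circle carries the normalized arc length: a function on it is measured
   and integrated through the parametrization [circ] of one period. *)
Definition period : set R := `[0, 2 * pi]%classic.

Definition ae_circle (P : T -> Prop) : Prop :=
  {ae mu, forall t : R, period t -> P (circ t)}.

(* Elements of L^2, H^2, ... are represented by functions, so that equality of
   elements is equality almost everywhere. The spaces L2, Linfty, H2, Hinfty, the
   [ominus] of two of them, and the kernels below consist of all the measurable
   representatives of their elements, so they may be compared as sets. *)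
Definition ae_eqT (f g : T -> C) : Prop := ae_circle (fun w => f w = g w).

Definition measurableT (f : T -> C) : Prop :=
  measurable_fun period (fun t => complex.Re (f (circ t))) /\
  measurable_fun period (fun t => complex.Im (f (circ t))).

Definition integralT (f : T -> C) : C :=
  ((2 * pi)^-1)%:C *
  ((\int[mu]_(t in period) complex.Re (f (circ t))) +i*
   (\int[mu]_(t in period) complex.Im (f (circ t)))).

Definition L2 : set (T -> C) := [set f | measurableT f /\
  (\int[mu]_(t in period) (cabs (f (circ t)) ^+ 2)%:E < +oo)%E].

Definition Linfty : set (T -> C) := [set f | measurableT f /\
  exists M : R, ae_circle (fun w => cabs (f w) <= M)].

Definition inner_prod (f g : T -> C) : C :=
  integralT (fun w => f w * (g w)^*).

Definition ominus (M N : set (T -> C)) : set (T -> C) :=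
  [set f | M f /\ forall g, N g -> inner_prod f g = 0].

Definition zfun : T -> C := fun w => val w.

Definition holomorphic_disc (F : C -> C) : Prop :=
  forall z : C, cabs z < 1 -> derivable (F : C^o -> C^o) z 1.

Definition H2_disc (F : C -> C) : Prop := holomorphic_disc F /\
  exists M : R, forall r : R, 0 <= r < 1 ->
    (\int[mu]_(t in period) (cabs (F (r%:C * val (circ t))) ^+ 2)%:E <= M%:E)%E.

Definition Hinfty_disc (F : C -> C) : Prop := holomorphic_disc F /\
  exists M : R, forall z : C, cabs z < 1 -> cabs (F z) <= M.

(* Radial limits. *)
Definition boundary_function (F : C -> C) (f : T -> C) : Prop :=
  measurableT f /\
  ae_circle (fun w => (F (r%:C * val w) : C^o) @[r --> 1^'-] --> (f w : C^o)).

Definition H2 : set (T -> C) :=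
  [set f | L2 f /\ exists2 F, H2_disc F & boundary_function F f].

Definition Hinfty : set (T -> C) :=
  [set f | Linfty f /\ exists2 F, Hinfty_disc F & boundary_function F f].

Definition H2minus : set (T -> C) := ominus L2 H2.

Definition inner_function (f : T -> C) : Prop :=
  Hinfty f /\ ae_circle (fun w => cabs (f w) = 1).

(* z |-> c * exp ((2 pi)^-1 \int (e^{it} + z) / (e^{it} - z) k(e^{it}) dt) *)
Definition outer_disc (c : C) (k : T -> R) (z : C) : C :=
  c * cexp (integralT (fun w => (val w + z) / (val w - z) * (k w)%:C)).

Definition outer_function (f : T -> C) : Prop :=
  exists (c : C) (k : T -> R),
    [/\ cabs c = 1, mu.-integrable period (fun t => (k (circ t))%:E) &
        boundary_function (outer_disc c k) f].

Definition model_space (b : T -> C) : set (T -> C) :=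
  ominus H2 [set b \* h | h in H2].

(* Operators are given by their graphs, since their values are only defined up
   to equality almost everywhere: [Pplus f g] means that g represents P^+ f. *)
Definition orth_proj (M : set (T -> C)) (f g : T -> C) : Prop :=
  M g /\ ominus L2 M (f \- g).

Definition Pplus : (T -> C) -> (T -> C) -> Prop := orth_proj H2.

Definition Pminus (f g : T -> C) : Prop :=
  exists2 fp, Pplus f fp & ae_eqT g (f \- fp).

Definition toeplitz (G f g : T -> C) : Prop := Pplus (G \* f) g.

Definition paired (G f g : T -> C) : Prop :=
  exists fp fm, [/\ Pplus f fp, Pminus f fm & ae_eqT g (G \* fp \+ fm)].

Definition ker_on (E : set (T -> C)) (S : (T -> C) -> (T -> C) -> Prop) :
    set (T -> C) :=
  [set f | E f /\ S f (fun=> 0)].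

Definition image_graph (S : (T -> C) -> (T -> C) -> Prop) (A : set (T -> C)) :
    set (T -> C) :=
  [set g | exists2 f, A f & S f g].

Definition ker_toeplitz (G : T -> C) : set (T -> C) := ker_on H2 (toeplitz G).

Definition ker_paired (G : T -> C) : set (T -> C) := ker_on L2 (paired G).

End CircleFunctions.

(* Main.v *)
Require Import Defs.
From mathcomp Require Import all_boot all_order all_algebra.
From mathcomp Require Import complex.
From mathcomp Require Import all_classical all_reals all_analysis.
From mathcomp Require Import measurable_realfun ring lra.
Import Defs.
Import Order.TTheory GRing.Theory Num.Theory.
Import numFieldNormedType.Exports.
Set Implicit Arguments.
Unset Strict Implicit.
Unset Printing Implicit Defensive.
Local Open Scope classical_set_scope.
Local Open Scope complex_scope.
Local Open Scope ring_scope.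

(** Suppose that theta + f_- is in the kernel of G P^+ + P^-. Its P^+ part is
    theta, so G theta = - f_- and, theta being unimodular, conj G = z theta h
    with h = - conj (z f_-). This h is bounded, because f_- = - G theta is, and
    for j > 0 the integral of z^j h is, up to sign and conjugation, the inner
    product of f_- with z^(j-1), which is 0. A bounded function whose
    coefficients of negative index vanish is in H^infty
    ([Hinfty_of_moments]): its Poisson integral is analytic, and by Fatou's
    theorem ([fatou_poisson]) it has the given function as radial limit.

    For the kernels, f in H^2 is killed by T_G iff G f is orthogonal to H^2, and
    then f - G f is in the kernel of the paired operator and has f as its P^+
    part ([image_ker_paired]). Put b = z theta G_i, so that conj G = b G_o and
    <G f, h> = <f, b G_o h>. Thus ker T_G is the orthogonal complement in H^2 of
    b G_o H^2, and K_b that of b H^2. One inclusion holds because G_o is in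
    H^infty: its modulus is exp k on the circle, so k is bounded above, and so
    is the Poisson integral of k.

    The other inclusion is the cyclicity of the outer function G_o
    ([outer_cyclic]): an integrable psi such that psi G_o q has mean 0 for all q
    in H^infty has mean 0 itself. For this, G_o is multiplied by approximate
    inverses q, namely dilations of the outer function of log-modulus
    - max (k, - n). A dilation is analytic across the circle, so its boundary
    values raise no question. The mean of v = G_o q is the value at 0 of an
    analytic function, exp (- a_n), where a_n is the mean of max (0, - k - n)
    and tends to 0 ([outer_mean]); and |v| tends to exp (- max (0, - k - n)),
    which is at most 1, as the dilation factor tends to 1. Expanding
    |v - 1|^2 = |v|^2 - 2 Re v + 1 shows that v is close to 1 in L^2, hence the
    mean of psi close to that of psi v, which is 0.

    Two points of function theory are treated directly. The mean value property
    of the exponential of a Herglotz integral comes from uniform approximation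
    by polynomials (Taylor expansion of the kernel, then Euler's formula
    exp a = lim (1 + a / N)^N), without Cauchy's theorem. Fatou's theorem, for
    Poisson integrals of integrable functions, is proved at Lebesgue points by
    dominating the Poisson kernel by indicators of dyadic intervals. *)

(** * Complex modulus, convergence and exponential *)

Arguments cabs : simpl never.

Section Modulus.
Context {R : realType}.
Local Notation C := R[i].
Implicit Types (z a b : C) (x y : R).

Lemma normc_cabs z : `|z| = (cabs z)%:C. Proof. by []. Qed.

Lemma cabs_sqr z : cabs z ^+ 2 = complex.Re z ^+ 2 + complex.Im z ^+ 2.
Proof. by case: z => u v; rewrite /cabs /= sqr_sqrtr// addr_ge0// sqr_ge0. Qed.

Lemma cabs_ge0 z : 0 <= cabs z.
Proof. by case: z => u v; rewrite /cabs /= sqrtr_ge0. Qed.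

Lemma cabs0 : cabs (0 : C) = 0.
Proof. exact: ComplexField.Normc.normc0. Qed.

Lemma cabs1 : cabs (1 : C) = 1.
Proof. exact: ComplexField.Normc.normc1. Qed.

Lemma cabs_eq0 z : (cabs z == 0) = (z == 0).
Proof.
apply/eqP/eqP => [|->]; last exact: cabs0.
exact: ComplexField.Normc.eq0_normc.
Qed.

Lemma cabs_gt0 z : (0 < cabs z) = (z != 0).
Proof. by rewrite lt_neqAle cabs_ge0 andbT eq_sym cabs_eq0. Qed.

Lemma cabsM a b : cabs (a * b) = cabs a * cabs b.
Proof. exact: ComplexField.Normc.normcM. Qed.

Lemma cabsV a : cabs a^-1 = (cabs a)^-1.
Proof. exact: ComplexField.Normc.normcV. Qed.

Lemma cabsX a n : cabs (a ^+ n) = cabs a ^+ n.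
Proof. by elim: n => [|n IH]; rewrite ?expr0 ?cabs1// !exprS cabsM IH. Qed.

Lemma cabsN a : cabs (- a) = cabs a.
Proof. exact: normcN. Qed.

Lemma cabs_distC a b : cabs (a - b) = cabs (b - a).
Proof. by rewrite -cabsN opprB. Qed.

Lemma le_cabsD a b : cabs (a + b) <= cabs a + cabs b.
Proof. exact: le_normcD. Qed.

Lemma le_cabsB a b : cabs (a - b) <= cabs a + cabs b.
Proof. by rewrite -(cabsN b) le_cabsD. Qed.

Lemma lerB_cabs a b : cabs a - cabs b <= cabs (a - b).
Proof. by rewrite lerBlDr -{1}(subrK b a) le_cabsD. Qed.

Lemma cabsJ a : cabs a^* = cabs a.
Proof. by case: a => u v; rewrite /cabs /= sqrrN. Qed.

Lemma cabsR x : cabs x%:C = `|x|.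
Proof. by rewrite /cabs /= expr0n addr0 sqrtr_sqr. Qed.

Lemma cabs_nat n : cabs (n%:R : C) = n%:R.
Proof. by rewrite -[n%:R]/(n%:R : C) -(rmorph_nat (real_complex R)) cabsR ger0_norm. Qed.

Lemma Re_le_cabs z : `|complex.Re z| <= cabs z.
Proof.
rewrite -(@ler_pXn2r _ 2)// ?nnegrE ?cabs_ge0// cabs_sqr real_normK ?num_real//.
by rewrite lerDl sqr_ge0.
Qed.

Lemma Im_le_cabs z : `|complex.Im z| <= cabs z.
Proof.
rewrite -(@ler_pXn2r _ 2)// ?nnegrE ?cabs_ge0// cabs_sqr real_normK ?num_real//.
by rewrite lerDr sqr_ge0.
Qed.

Lemma cabs_le_ReIm z : cabs z <= `|complex.Re z| + `|complex.Im z|.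
Proof.
case: z => u v /=.
have -> : u +i* v = u%:C + 'i * v%:C.
  by apply/eqP; rewrite eq_complex /= !(mul0r,mul1r,add0r,addr0,subr0,mulr0) !eqxx.
rewrite (le_trans (le_cabsD _ _))// cabsM !cabsR.
have -> : cabs ('i : C) = 1 by rewrite /cabs /= expr0n add0r expr1n sqrtr1.
by rewrite mul1r.
Qed.

Lemma cReD a b : complex.Re (a + b) = complex.Re a + complex.Re b.
Proof. by case: a; case: b. Qed.
Lemma cImD a b : complex.Im (a + b) = complex.Im a + complex.Im b.
Proof. by case: a; case: b. Qed.
Lemma cReN a : complex.Re (- a) = - complex.Re a.
Proof. by case: a. Qed.
Lemma cImN a : complex.Im (- a) = - complex.Im a.
Proof. by case: a. Qed.
Lemma cReM a b :
  complex.Re (a * b) = complex.Re a * complex.Re b - complex.Im a * complex.Im b.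
Proof. by case: a; case: b. Qed.
Lemma cImM a b :
  complex.Im (a * b) = complex.Re a * complex.Im b + complex.Im a * complex.Re b.
Proof. by case: a => ? ?; case: b. Qed.
Lemma cReJ a : complex.Re a^* = complex.Re a. Proof. by case: a. Qed.
Lemma cImJ a : complex.Im a^* = - complex.Im a. Proof. by case: a. Qed.
Lemma cReV a : complex.Re a^-1 = complex.Re a / cabs a ^+ 2.
Proof. by rewrite cabs_sqr; case: a. Qed.
Lemma cImV a : complex.Im a^-1 = - complex.Im a / cabs a ^+ 2.
Proof. by rewrite cabs_sqr; case: a => u v /=; rewrite mulNr. Qed.

Lemma mulcJ z : z * z^* = (cabs z ^+ 2)%:C.
Proof.
apply/eqP; rewrite eq_complex cabs_sqr; case: z => u v /=.
by apply/andP; split; apply/eqP; ring.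
Qed.

Lemma invc_unit z : cabs z = 1 -> z^-1 = z^*.
Proof.
move=> z1; have z0 : z != 0 by rewrite -cabs_gt0 z1.
by apply: (mulfI z0); rewrite mulfV// mulcJ z1 expr1n.
Qed.

Lemma conjcM a b : (a * b)^* = a^* * b^*. Proof. exact: rmorphM. Qed.
Lemma conjcN a : (- a)^* = - a^*. Proof. exact: rmorphN. Qed.
Lemma conjcX a n : (a ^+ n)^* = a^* ^+ n. Proof. exact: rmorphXn. Qed.

Lemma eq_ReIm a b : complex.Re a = complex.Re b -> complex.Im a = complex.Im b -> a = b.
Proof. by case: a b => ? ? [? ?] /= -> ->. Qed.

End Modulus.

Section Convergence.
Context {R : realType}.
Local Notation C := R[i].

(** The ring R[i] measures distances by elements of R[i]; this turns
    convergence into convergence of a real quantity. *)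
Lemma cvgC {T : Type} {F : set_system T} {FF : Filter F} (f : T -> C) (l : C) :
  ((f x : C^o) @[x --> F] --> (l : C^o)) <-> (cabs (f x - l) @[x --> F] --> (0 : R)).
Proof.
split=> [/cvgrPdist_lt h|/cvgrPdist_lt h].
- apply/cvgrPdist_lt => e e0; have /h : 0 < e%:C by rewrite ltcR.
  apply: filterS => x; rewrite normc_cabs ltcR cabs_distC.
  by rewrite sub0r normrN ger0_norm// cabs_ge0.
- apply/cvgrPdist_lt => e; case: e => e e' ; rewrite ltcE /= => /andP[/eqP -> e0].
  move: (h _ e0); apply: filterS => x.
  by rewrite sub0r normrN ger0_norm ?cabs_ge0// normc_cabs cabs_distC -ltcR.
Qed.

Lemma cvgC_Re {T : Type} {F : set_system T} {FF : Filter F} (f : T -> C) (l : C) :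
  ((f x : C^o) @[x --> F] --> (l : C^o)) ->
  complex.Re (f x) @[x --> F] --> complex.Re l.
Proof.
move=> /cvgC/cvgrPdist_lt h; apply/cvgrPdist_lt => e /h; apply: filterS => x.
rewrite sub0r normrN ger0_norm ?cabs_ge0//; apply: le_lt_trans.
by rewrite -cReN -cReD cabs_distC Re_le_cabs.
Qed.

Lemma cvgC_Im {T : Type} {F : set_system T} {FF : Filter F} (f : T -> C) (l : C) :
  ((f x : C^o) @[x --> F] --> (l : C^o)) ->
  complex.Im (f x) @[x --> F] --> complex.Im l.
Proof.
move=> /cvgC/cvgrPdist_lt h; apply/cvgrPdist_lt => e /h; apply: filterS => x.
rewrite sub0r normrN ger0_norm ?cabs_ge0//; apply: le_lt_trans.
by rewrite -cImN -cImD cabs_distC Im_le_cabs.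
Qed.

Lemma cvgC_cabs {T : Type} {F : set_system T} {FF : Filter F} (f : T -> C) (l : C) :
  ((f x : C^o) @[x --> F] --> (l : C^o)) ->
  cabs (f x) @[x --> F] --> cabs l.
Proof.
move=> /cvgC/cvgrPdist_lt h; apply/cvgrPdist_lt => e /h; apply: filterS => x.
rewrite sub0r normrN ger0_norm ?cabs_ge0//; apply: le_lt_trans.
by rewrite ler_norml lerNl opprB lerB_cabs cabs_distC lerB_cabs.
Qed.

Lemma cvgC_ReIm {T : Type} {F : set_system T} {FF : Filter F} (f : T -> C) (l : C) :
  complex.Re (f x) @[x --> F] --> complex.Re l ->
  complex.Im (f x) @[x --> F] --> complex.Im l ->
  ((f x : C^o) @[x --> F] --> (l : C^o)).
Proof.
move=> /cvgrPdist_lt hr /cvgrPdist_lt hi; apply/cvgC/cvgrPdist_lt => e e0.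
have e2 : 0 < e / 2 by rewrite divr_gt0.
near=> x.
rewrite sub0r normrN ger0_norm ?cabs_ge0// cabs_distC.
rewrite (le_lt_trans (cabs_le_ReIm _))// cReD cImD cReN cImN (splitr e) ltrD//; near: x.
- exact: hr.
- exact: hi.
Unshelve. all: by end_near. Qed.

End Convergence.

Section ComplexExponential.
Context {R : realType}.
Local Notation C := R[i].
Implicit Types (a b z : C).

Lemma cabs_cexp z : cabs (cexp z) = expR (complex.Re z).
Proof.
rewrite /cexp cabsM cabsR ger0_norm ?expR_ge0//.
by rewrite (eqP (cabs_cos_sin _)) mulr1.
Qed.

Lemma cexpD a b : cexp (a + b) = cexp a * cexp b.
Proof.
rewrite /cexp cReD cImD expRD cosD sinD; apply: eq_ReIm; rewrite /= ; ring.
Qed.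

Lemma cexp0 : cexp (0 : C) = 1.
Proof. by rewrite /cexp /= expR0 cos0 sin0 mul1r. Qed.

Lemma cexpMn z n : cexp (z *+ n) = cexp z ^+ n.
Proof. by elim: n => [|n IH]; rewrite ?mulr0n ?cexp0// mulrS cexpD IH exprS. Qed.

End ComplexExponential.

(** * Complex differentiability *)

Section Derivative.
Context {R : realType}.
Local Notation C := R[i].
Implicit Types (F G : C -> C) (z d h : C).

(** The derivative in epsilon-delta form, with a real epsilon and the
    increment cleared from the denominator, so that estimates of the remainder can
    be fed in directly. *)
Definition cderiv F z d := forall e : R, 0 < e -> exists2 r : R, 0 < r &
  forall h, cabs h < r -> cabs (F (z + h) - F z - d * h) <= e * cabs h.

Lemma nbhsC0 (P : C -> Prop) :
  (\forall h \near (0 : C^o), P h) <-> exists2 r : R, 0 < r & forall h, cabs h < r -> P h.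
Proof.
split=> [/nbhs_ballP[e e0 eP]|[r r0 rP]].
- move: e e0 eP => [e e'] /=; rewrite ltcE /= => /andP[/eqP -> e0] eP.
  exists e => // h hr; apply: eP; rewrite -ball_normE /= sub0r normrN.
  by rewrite normc_cabs ltcR.
- apply/nbhs_ballP; exists r%:C => /=; first by rewrite ltcR.
  by move=> h; rewrite -ball_normE /= sub0r normrN normc_cabs ltcR => /rP.
Qed.

Lemma cderivP F z d : cderiv F z d ->
  (h^-1 *: (F (h *: (1 : C^o) + z) - F z) : C^o) @[h --> (0 : C^o)^'] --> (d : C^o).
Proof.
move=> Fd; apply/cvgC/cvgrPdist_le => e e0.
have /nbhsC0 : exists2 r : R, 0 < r & forall h, cabs h < r ->
    cabs (F (z + h) - F z - d * h) <= e * cabs h by exact: Fd.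
move=> nh; near=> h.
have h0 : h != 0 by near: h; exact: (@nbhs_dnbhs_neq C^o 0).
rewrite sub0r normrN ger0_norm ?cabs_ge0//.
have -> : h^-1 *: (F (h *: (1 : C^o) + z) - F z) - d =
    h^-1 * (F (z + h) - F z - d * h).
  by rewrite /GRing.scale /= mulr1 (addrC h) [RHS]mulrBr mulrCA mulVf// mulr1.
rewrite cabsM cabsV ler_pdivrMl ?cabs_gt0// [leRHS]mulrC; near: h.
exact: (nbhs_dnbhs nh).
Unshelve. all: by end_near. Qed.

Lemma cderiv_derivable F z d : cderiv F z d -> derivable (F : C^o -> C^o) z 1.
Proof. by move=> /cderivP Fd; apply/cvg_ex; exists d. Qed.

Lemma derivable_cderiv F z : derivable (F : C^o -> C^o) z 1 -> exists d, cderiv F z d.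
Proof.
move=> /cvg_ex[d /= /cvgC/cvgrPdist_le Fd]; exists d => e /Fd.
rewrite near_withinE => /nbhsC0[r r0 rP]; exists r => // h /rP.
have [->|h0 /(_ isT)] := eqVneq h 0; first by rewrite addr0 subrr mulr0 subr0 cabs0 mulr0.
rewrite sub0r normrN ger0_norm ?cabs_ge0//.
have -> : h^-1 *: (F (h *: (1 : C^o) + z) - F z) - d =
    h^-1 * (F (z + h) - F z - d * h).
  by rewrite /GRing.scale /= mulr1 (addrC h) [RHS]mulrBr mulrCA mulVf// mulr1.
by rewrite cabsM cabsV ler_pdivrMl ?cabs_gt0// [leRHS]mulrC.
Qed.

Lemma cderiv_continuous F z d : cderiv F z d -> {for z, continuous (F : C^o -> C^o)}.
Proof.
move=> /cderiv_derivable Fz; apply: differentiable_continuous.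
exact/derivable1_diffP.
Qed.

Lemma is_derive0_le (f : R -> R) (d : R) : is_derive (0 : R) 1 f d ->
  forall e : R, 0 < e -> exists2 r : R, 0 < r &
  forall x, `|x| < r -> `|f x - f 0 - d * x| <= e * `|x|.
Proof.
move=> fd e e0; have : h^-1 *: (f (h *: 1 + 0) - f 0) @[h --> (0 : R)^'] --> d.
  have := @ex_derive _ _ _ _ _ _ _ fd.
  by rewrite /derivable -(@derive_val _ _ _ _ _ _ _ fd).
move=> /cvgrPdist_le/(_ _ e0); rewrite near_withinE => /nbhs_ballP[r /= r0 rP].
exists r => // x xr; have [->|x0] := eqVneq x 0.
  by rewrite subrr mulr0 subr0 normr0 mulr0.
have := rP x; rewrite /ball /= sub0r normrN => /(_ xr x0).
rewrite /GRing.scale /= mulr1 addr0 => h.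
have -> : f x - f 0 - d * x = - (x * (d - x^-1 * (f x - f 0))).
  by rewrite mulrBr mulVKf// opprB mulrC.
by rewrite normrN normrM mulrC ler_wpM2r.
Qed.

(** Split e^a cos b - 1 - a and e^a sin b - b, where h = a + i b, into terms
    each containing one of the first-order errors of exp, sin and cos at 0 or the
    second-order product a sin b. *)
Lemma cderiv_cexp0 : cderiv (@cexp R) 0 1.
Proof.
move=> e e0; pose e1 := Num.min (e / 8) 1.
have e10 : 0 < e1 by rewrite lt_min divr_gt0//=.
have e11 : e1 <= 1 by rewrite ge_min lexx orbT.
have e1e : e1 <= e / 8 by rewrite ge_min lexx.
clearbody e1.
have [r1 r10 h1] := is_derive0_le (is_derive_expR (0 : R)) e10.
have [r2 r20 h2] := is_derive0_le (is_derive_sin (0 : R)) e10.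
have [r3 r30 h3] := is_derive0_le (is_derive_cos (0 : R)) e10.
(* the bound |h| < e1 makes the second-order term a sin b at most 2 e1 |h|;
   the errors add up to at most 8 e1 |h| *)
exists (Num.min e1 (Num.min r1 (Num.min r2 r3))); first by rewrite !lt_min e10 r10 r20.
move=> h; rewrite !lt_min => /and4P[he hr1 hr2 hr3].
set a := complex.Re h; set b := complex.Im h.
have ah : `|a| <= cabs h := Re_le_cabs h.
have bh : `|b| <= cabs h := Im_le_cabs h.
have := h1 a (le_lt_trans ah hr1); have := h2 b (le_lt_trans bh hr2).
have := h3 b (le_lt_trans bh hr3); rewrite expR0 cos0 sin0 oppr0 mul0r !addr0 !subr0 !mul1r.
move=> cb sb eb; rewrite add0r cexp0 (le_trans (cabs_le_ReIm _))//.
rewrite !(cReD, cImD, cReN, cImN) /cexp cReM cImM /= -/a -/b.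
rewrite ?(mul0r,mul1r,addr0,subr0,oppr0).
have c1 : `|cos b| <= 1 by rewrite ler_norml cos_geN1 cos_le1.
have a1 : `|1 + a| <= 2.
  rewrite (le_trans (ler_normD _ _))// normr1; have := ltW (le_lt_trans ah he); lra.
have -> : expR a * cos b - 1 - a = (expR a - 1 - a) * cos b + (1 + a) * (cos b - 1).
  ring.
have -> : expR a * sin b - b = (expR a - 1 - a) * sin b + a * sin b + (sin b - b).
  ring.
have b1 : `|sin b| <= 2 * `|b|.
  have -> : sin b = (sin b - b) + b by ring.
  rewrite (le_trans (ler_normD _ _))//.
  have : e1 * `|b| <= `|b| by rewrite ler_piMl.
  lra.
have s1 : `|sin b| <= 1 by rewrite ler_norml sin_geN1 sin_le1.
have p1 : `|(expR a - 1 - a) * cos b| <= e1 * cabs h.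
  rewrite normrM; apply: le_trans (ler_wpM2l (normr_ge0 _) c1) _.
  by rewrite mulr1 (le_trans eb)// ler_wpM2l// ltW.
have p2 : `|(1 + a) * (cos b - 1)| <= 2 * (e1 * cabs h).
  by rewrite normrM ler_pM// (le_trans cb)// ler_wpM2l// ltW.
have p3 : `|(expR a - 1 - a) * sin b| <= e1 * cabs h.
  rewrite normrM; apply: le_trans (ler_wpM2l (normr_ge0 _) s1) _.
  by rewrite mulr1 (le_trans eb)// ler_wpM2l// ltW.
have p4 : `|a * sin b| <= 2 * (e1 * cabs h).
  rewrite normrM; apply: (@le_trans _ _ (e1 * (2 * cabs h))); last by lra.
  by rewrite ler_pM// ?(le_trans ah (ltW he))// (le_trans b1)// ler_wpM2l.
have p5 : `|sin b - b| <= e1 * cabs h by rewrite (le_trans sb)// ler_wpM2l// ltW.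
have q : 8 * (e1 * cabs h) <= e * cabs h.
  have := ler_wpM2r (cabs_ge0 h) e1e; lra.
have := ler_normD ((expR a - 1 - a) * cos b) ((1 + a) * (cos b - 1)).
have := ler_normD ((expR a - 1 - a) * sin b + a * sin b) (sin b - b).
have := ler_normD ((expR a - 1 - a) * sin b) (a * sin b).
have := mulr_ge0 (ltW e10) (cabs_ge0 h).
lra.
Qed.

Lemma cderiv_lip F z d : cderiv F z d -> exists2 r : R, 0 < r &
  forall h, cabs h < r -> cabs (F (z + h) - F z) <= (1 + cabs d) * cabs h.
Proof.
move=> /(_ _ ltr01)[r r0 rP]; exists r => // h /rP; rewrite mul1r mulrDl mul1r => hd.
rewrite -(subrK (d * h) (F (z + h) - F z)) (le_trans (le_cabsD _ _))//.
by rewrite cabsM lerD2r.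
Qed.

(** Since cexp (F z + k) = cexp (F z) cexp k, only the derivative of cexp at 0
    matters. *)
Lemma cderiv_cexp F z d : cderiv F z d -> cderiv (fun w => cexp (F w)) z (cexp (F z) * d).
Proof.
move=> Fd e e0.
set E := cabs (cexp (F z)); set K := 1 + cabs d.
have E0 : 0 <= E by exact: cabs_ge0.
have K0 : 0 < K by rewrite ltr_pwDl// cabs_ge0.
have e20 : 0 < e / (2 * (1 + E)) by rewrite divr_gt0// mulr_gt0// ltr_pwDl.
have e30 : 0 < e / (2 * (1 + E)) / K by rewrite divr_gt0.
have [r1 r10 h1] := Fd _ e20; have [r2 r20 h2] := cderiv_lip Fd.
have [r3 r30 h3] := cderiv_cexp0 e30.
exists (Num.min r1 (Num.min r2 (r3 / K))); first by rewrite !lt_min r10 r20 divr_gt0.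
move=> h; rewrite !lt_min => /and3P[/h1 hr1 /h2 hr2 hr3] /=.
set k := F (z + h) - F z in hr1 hr2 *.
have kr3 : cabs k < r3 by rewrite (le_lt_trans hr2)// mulrC -ltr_pdivlMr.
have := h3 _ kr3; rewrite add0r cexp0 mul1r => hk.
have -> : F (z + h) = F z + k by rewrite /k [RHS]addrC subrK.
rewrite cexpD.
have -> : cexp (F z) * cexp k - cexp (F z) - cexp (F z) * d * h =
  cexp (F z) * ((cexp k - 1 - k) + (k - d * h)) by ring.
rewrite cabsM -/E.
have q : cabs (cexp k - 1 - k + (k - d * h)) <= e / (1 + E) * cabs h.
  rewrite (le_trans (le_cabsD _ _))//.
  have -> : e / (1 + E) * cabs h = e / (2 * (1 + E)) / K * (K * cabs h) + e / (2 * (1 + E)) * cabs h.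
    by field; rewrite !gt_eqF// ltr_pwDl.
  by rewrite lerD// (le_trans hk)// ler_wpM2l// ltW.
apply: le_trans (ler_wpM2l E0 q) _.
rewrite mulrA ler_wpM2r ?cabs_ge0// mulrCA ler_piMr//; first exact: ltW.
by rewrite ler_pdivrMr ?ltr_pwDl// mul1r lerDr.
Qed.

Lemma cderiv_scale F (r : R) z d : 0 < r -> cderiv F (r%:C * z) d ->
  cderiv (fun w => F (r%:C * w)) z (r%:C * d).
Proof.
move=> r0 Fd e e0; have [s s0 sP] := Fd (e / r) (divr_gt0 e0 r0).
exists (s / r); first by rewrite divr_gt0.
move=> h; rewrite ltr_pdivlMr// => hr.
have := sP (r%:C * h); rewrite cabsM cabsR gtr0_norm// mulrC => /(_ hr).
by rewrite mulrDr mulrA [d * _]mulrC mulrAC [s in _ <= s -> _](_ : _ = e * cabs h)//; field; rewrite gt_eqF.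
Qed.

End Derivative.

(** * Means of real functions on the circle *)

Section CircleIntegral.
Context {R : realType}.
Local Notation C := R[i].
Local Notation T := (circle R).
Local Notation mu := (@lebesgue_measure R).
Local Notation period := (@period R).
Implicit Types (u v g : T -> R) (P Q S : T -> Prop).

(** [ae_circle] mentions the bare function [lebesgue_measure], and not the
    measure that it underlies. *)
#[global] Instance ae_lebesgue_filter : Filter (almost_everywhere mu).
Proof. exact: ae_filter_ringOfSetsType. Qed.

Lemma twopi_gt0 : 0 < 2 * pi :> R.
Proof. by rewrite mulr_gt0// pi_gt0. Qed.

Lemma measurable_period :
  (measurable : set (set (g_sigma_algebraType R.-ocitv.-measurable))) period.
Proof. exact: measurable_itv. Qed.
Local Hint Resolve measurable_period : core.

Lemma mu_period : (mu period = (2 * pi)%:E)%E.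
Proof.
by rewrite /period lebesgue_measure_itv/= lte_fin twopi_gt0 sube0.
Qed.

Lemma ae_circleW P : (forall w, P w) -> ae_circle P.
Proof. by move=> h; apply: aeW => t _. Qed.

Lemma ae_circleS P Q : (forall w, P w -> Q w) -> ae_circle P -> ae_circle Q.
Proof. by move=> PQ; rewrite /ae_circle; apply: filterS => t + pt => /(_ pt); exact: PQ. Qed.

Lemma ae_circleS2 P Q S : (forall w, P w -> Q w -> S w) ->
  ae_circle P -> ae_circle Q -> ae_circle S.
Proof. by move=> PQ; rewrite /ae_circle; apply: filterS2 => t + + pt => /(_ pt) + /(_ pt); exact: PQ. Qed.

Lemma ae_circleS3 P Q S S' : (forall w, P w -> Q w -> S w -> S' w) ->
  ae_circle P -> ae_circle Q -> ae_circle S -> ae_circle S'.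
Proof.
move=> PQ; rewrite /ae_circle; apply: filterS3 => t + + + pt => /(_ pt) + /(_ pt) + /(_ pt); exact: PQ.
Qed.

Lemma ae_circle_forall (P : nat -> T -> Prop) : (forall n, ae_circle (P n)) ->
  ae_circle (fun w => forall n, P n w).
Proof.
move=> h; rewrite /ae_circle.
have : {ae mu, forall t n, period t -> P n (circ t)} by apply/ae_foralln.
by apply: filterS => t ht pt n; exact: ht.
Qed.

Definition measR u := measurable_fun period (fun t => u (circ t)).
Definition intT u := mu.-integrable period (fun t => (u (circ t))%:E).
Definition avg u : R := (2 * pi)^-1 * \int[mu]_(t in period) u (circ t).

Lemma intT_meas u : intT u -> measR u.
Proof. by move=> /measurable_int/measurable_EFinP. Qed.

Lemma intTP u : intT u <->
  measR u /\ (\int[mu]_(t in period) `|u (circ t)|%:E < +oo)%E.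
Proof.
split=> [iu|[mu_ iu]]; last by apply/integrableP; split=> //; exact/measurable_EFinP.
by split; [exact: intT_meas|case/integrableP : iu].
Qed.

Lemma measR_cst (c : R) : measR (fun=> c).
Proof. exact: measurable_cst. Qed.
Lemma measRD u v : measR u -> measR v -> measR (fun w => u w + v w).
Proof. exact: measurable_funD. Qed.
Lemma measRB u v : measR u -> measR v -> measR (fun w => u w - v w).
Proof. exact: measurable_funB. Qed.
Lemma measRM u v : measR u -> measR v -> measR (fun w => u w * v w).
Proof. exact: measurable_funM. Qed.
Lemma measRN u : measR u -> measR (fun w => - u w).
Proof. exact: measurable_funN. Qed.
Lemma measRX u n : measR u -> measR (fun w => u w ^+ n).
Proof. exact: measurable_funX. Qed.
Lemma measR_norm u : measR u -> measR (fun w => `|u w|).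
Proof. by move=> h; apply: measurableT_comp. Qed.
Lemma measR_max u v : measR u -> measR v -> measR (fun w => Num.max (u w) (v w)).
Proof. exact: measurable_maxr. Qed.
Lemma measR_exp u : measR u -> measR (fun w => expR (u w)).
Proof. by move=> h; apply: measurableT_comp => //; exact: measurable_expR. Qed.
Lemma measR_cont u (f : R -> R) : continuous f -> measR u -> measR (fun w => f (u w)).
Proof. by move=> cf h; apply: measurableT_comp => //; exact: continuous_measurable_fun. Qed.
Lemma measR_sqrt u : measR u -> measR (fun w => Num.sqrt (u w)).
Proof. by apply: (measR_cont (f := Num.sqrt)) => x; exact: sqrt_continuous. Qed.

Lemma le_intT u g : measR u -> intT g -> ae_circle (fun w => `|u w| <= g w) -> intT u.
Proof.
move=> mu_ ig ug; apply/intTP; split => //.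
have [mg gy] := (intTP _).1 ig; apply: le_lt_trans gy.
apply: ae_ge0_le_integral => //.
- by apply/measurable_EFinP; exact: measR_norm.
- by apply/measurable_EFinP; exact: measR_norm.
have h : ae_circle (fun w => (`|u w|%:E <= `|g w|%:E)%E); last exact: h.
by apply: ae_circleS ug => w h; rewrite lee_fin (le_trans h)// ler_norm.
Qed.

Lemma intT_cst (c : R) : intT (fun=> c).
Proof.
apply/intTP; split; first exact: measR_cst.
rewrite (_ : (fun=> _) = cst `|c|%:E)// integral_cst//.
by have := mu_period => /= ->; rewrite -EFinM ltry.
Qed.

Lemma intT_bdd u (M : R) : measR u -> ae_circle (fun w => `|u w| <= M) -> intT u.
Proof. by move=> mu_ uM; apply: le_intT uM => //; exact: intT_cst. Qed.

Lemma intTD u v : intT u -> intT v -> intT (fun w => u w + v w).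
Proof. by move=> iu iv; have := integrableD measurable_period iu iv. Qed.
Lemma intTB u v : intT u -> intT v -> intT (fun w => u w - v w).
Proof. by move=> iu iv; have := integrableB measurable_period iu iv. Qed.
Lemma intTZ (c : R) u : intT u -> intT (fun w => c * u w).
Proof. by move=> iu; have := integrableZl measurable_period c iu. Qed.
Lemma intTN u : intT u -> intT (fun w => - u w).
Proof. by move=> iu; have := integrableN iu. Qed.
Lemma intT_norm u : intT u -> intT (fun w => `|u w|).
Proof. by move=> iu; have := integrable_norm iu. Qed.

Lemma avgD u v : intT u -> intT v -> avg (fun w => u w + v w) = avg u + avg v.
Proof. by move=> iu iv; rewrite /avg RintegralD// mulrDr. Qed.
Lemma avgB u v : intT u -> intT v -> avg (fun w => u w - v w) = avg u - avg v.
Proof. by move=> iu iv; rewrite /avg RintegralB// mulrBr. Qed.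
Lemma avgZ (c : R) u : intT u -> avg (fun w => c * u w) = c * avg u.
Proof. by move=> iu; rewrite /avg RintegralZl// mulrCA. Qed.
Lemma avgN u : intT u -> avg (fun w => - u w) = - avg u.
Proof.
move=> iu; rewrite -mulN1r -avgZ//; congr avg.
by apply/funext => w; rewrite mulN1r.
Qed.

Lemma avg_cst (c : R) : avg (fun=> c) = c.
Proof.
rewrite /avg Rintegral_cst//; have := mu_period => /= ->; rewrite /= mulrCA mulVf ?mulr1//.
by rewrite gt_eqF// twopi_gt0.
Qed.

Lemma avg_ge0 u : (forall w, 0 <= u w) -> 0 <= avg u.
Proof.
move=> u0; rewrite /avg mulr_ge0 ?invr_ge0 ?(ltW twopi_gt0)//.
by apply: Rintegral_ge0.
Qed.

Lemma eq_avg_ae u v : measR u -> measR v -> ae_circle (fun w => u w = v w) ->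
  avg u = avg v.
Proof.
move=> mu_ mv uv; rewrite /avg /Rintegral; congr (_ * fine _).
apply: ae_eq_integral => //; try exact/measurable_EFinP.
have h : ae_circle (fun w => (u w)%:E = (v w)%:E); last exact: h.
by apply: ae_circleS uv => w ->.
Qed.

Lemma le_avg_ae u v : intT u -> intT v -> ae_circle (fun w => u w <= v w) ->
  avg u <= avg v.
Proof.
move=> iu iv uv; rewrite -subr_ge0 -avgB//.
rewrite (@eq_avg_ae _ (fun w => `|v w - u w|)).
- by apply: avg_ge0.
- by apply: measRB; exact: intT_meas.
- by apply: measR_norm; apply: measRB; exact: intT_meas.
- by apply: ae_circleS uv => w h; rewrite ger0_norm// subr_ge0.
Qed.

Lemma le_avg u v : intT u -> intT v -> (forall w, u w <= v w) -> avg u <= avg v.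
Proof. by move=> iu iv uv; apply: le_avg_ae => //; exact: ae_circleW. Qed.

Lemma le_norm_avg u : intT u -> `|avg u| <= avg (fun w => `|u w|).
Proof.
move=> iu; rewrite /avg normrM gtr0_norm ?invr_gt0 ?twopi_gt0//.
rewrite ler_wpM2l ?invr_ge0 ?(ltW twopi_gt0)//.
exact: le_normr_Rintegral.
Qed.

Lemma avg_dominated (u_ : nat -> T -> R) u g :
  (forall n, measR (u_ n)) -> measR u -> intT g ->
  ae_circle (fun w => u_ n w @[n --> \oo] --> u w) ->
  (forall n, ae_circle (fun w => `|u_ n w| <= g w)) ->
  intT u /\ avg (u_ n) @[n --> \oo] --> avg u.
Proof.
move=> mu_ mu0 ig uu ug.
have [|||||iu _ cu] := @dominated_convergence _ _ _ mu _ measurable_period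
  (fun n t => (u_ n (circ t))%:E) (fun t => (u (circ t))%:E) (fun t => (g (circ t))%:E).
- by move=> n; apply/measurable_EFinP; exact: mu_.
- by apply/measurable_EFinP.
- have h : ae_circle (fun w => (u_ n w)%:E @[n --> \oo] --> (u w)%:E); last exact: h.
  by apply: ae_circleS uu => w h; apply/cvg_EFin; [exact: nearW|exact: h].
- exact: ig.
- have /= h : {ae mu, forall t n, period t -> (`|(u_ n (circ t))%:E| <= (g (circ t))%:E)%E}.
    have := ae_circle_forall ug; rewrite /ae_circle.
    by apply: filterS => t + n pt => /(_ pt n) h; rewrite lee_fin.
  exact: h.
split; first exact: iu.
apply: cvgMr; apply: fine_cvg; rewrite fineK//; exact: integrable_fin_num.
Qed.

End CircleIntegral.
#[global] Hint Resolve measurable_period : core.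

(** * Complex integrals and the space L2 *)

Section ComplexCircleIntegral.
Context {R : realType}.
Local Notation C := R[i].
Local Notation T := (circle R).
Local Notation mu := (@lebesgue_measure R).
Local Notation period := (@period R).
Implicit Types (u v : T -> R) (f g : T -> C) (c : C).

Lemma measurableT_cst c : measurableT (fun=> c : C).
Proof. by split; exact: measurable_cst. Qed.

Lemma measurableTD f g : measurableT f -> measurableT g -> measurableT (fun w => f w + g w).
Proof.
move=> [fr fi] [gr gi]; split.
- under eq_fun do rewrite cReD; exact: measurable_funD.
- under eq_fun do rewrite cImD; exact: measurable_funD.
Qed.

Lemma measurableTN f : measurableT f -> measurableT (fun w => - f w).
Proof.
move=> [fr fi]; split.
- under eq_fun do rewrite cReN; exact: measurable_funN.
- under eq_fun do rewrite cImN; exact: measurable_funN.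
Qed.

Lemma measurableTB f g : measurableT f -> measurableT g -> measurableT (fun w => f w - g w).
Proof. by move=> mf mg; apply: measurableTD => //; exact: measurableTN. Qed.

Lemma measurableTM f g : measurableT f -> measurableT g -> measurableT (fun w => f w * g w).
Proof.
move=> [fr fi] [gr gi]; split.
- by under eq_fun do rewrite cReM; apply: measurable_funB; exact: measurable_funM.
- by under eq_fun do rewrite cImM; apply: measurable_funD; exact: measurable_funM.
Qed.

Lemma measurableTX f n : measurableT f -> measurableT (fun w => f w ^+ n).
Proof.
move=> mf; elim: n => [|n IH]; first exact: measurableT_cst.
by under eq_fun do rewrite exprS; exact: measurableTM.
Qed.

Lemma measurableTJ f : measurableT f -> measurableT (fun w => (f w)^*).
Proof.
move=> [fr fi]; split.
- by under eq_fun do rewrite cReJ.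
- under eq_fun do rewrite cImJ; exact: measurable_funN.
Qed.

Lemma measR_Re f : measurableT f -> measR (fun w => complex.Re (f w)).
Proof. by case. Qed.
Lemma measR_Im f : measurableT f -> measR (fun w => complex.Im (f w)).
Proof. by case. Qed.

Lemma measR_cabs_sqr f : measurableT f -> measR (fun w => cabs (f w) ^+ 2).
Proof.
move=> [mr mi]; rewrite /measR; under eq_fun do rewrite cabs_sqr.
by apply: measurable_funD; exact: measurable_funX.
Qed.

Lemma measR_cabs f : measurableT f -> measR (fun w => cabs (f w)).
Proof.
move=> /measR_cabs_sqr/measR_sqrt; rewrite /measR.
by under eq_fun do rewrite sqrtr_sqr ger0_norm ?cabs_ge0//.
Qed.

(** x^-1 = x exp (- ln (x ^ 2)) for x <> 0 reduces the inverse to measurable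
    functions. *)
Lemma measR_inv u : measR u -> (forall w, u w != 0) -> measR (fun w => (u w)^-1).
Proof.
move=> mu_ u0; have -> : (fun w => (u w)^-1) = fun w => u w * expR (- ln (u w ^+ 2)).
  apply/funext => w; rewrite expRN lnK ?posrE ?exprn_even_gt0//=.
  by field.
apply: measRM => //; apply: measR_exp; apply: measRN.
by apply: measurableT_comp; [exact: measurable_ln|exact: measRX].
Qed.

Lemma measurableTV f : measurableT f -> (forall w, f w != 0) ->
  measurableT (fun w => (f w)^-1).
Proof.
move=> mf f0; have mi : measR (fun w => (cabs (f w) ^+ 2)^-1).
  apply: measR_inv => [|w]; first exact: measR_cabs_sqr.
  by rewrite expf_neq0// cabs_eq0.
split.
- under eq_fun do rewrite cReV.
  exact: (measRM (measR_Re mf) mi).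
- under eq_fun do rewrite cImV.
  exact: (measRM (measRN (measR_Im mf)) mi).
Qed.

Lemma measurableT_zfun : measurableT (@zfun R).
Proof.
split; apply: measurable_funTS; apply: continuous_measurable_fun => x /=.
- exact: continuous_cos.
- exact: continuous_sin.
Qed.

Definition L1 f := intT (fun w => complex.Re (f w)) /\ intT (fun w => complex.Im (f w)).

Lemma L1_meas f : L1 f -> measurableT f.
Proof. by move=> [/intT_meas ? /intT_meas]. Qed.

Lemma le_L1 f u : measurableT f -> intT u -> ae_circle (fun w => cabs (f w) <= u w) -> L1 f.
Proof.
move=> mf iu fu; split; apply: (le_intT _ iu).
- exact: measR_Re.
- by apply: ae_circleS fu => w; apply: le_trans; exact: Re_le_cabs.
- exact: measR_Im.
- by apply: ae_circleS fu => w; apply: le_trans; exact: Im_le_cabs.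
Qed.

Lemma L1_bdd f (M : R) : measurableT f -> ae_circle (fun w => cabs (f w) <= M) -> L1 f.
Proof. by move=> mf; apply: le_L1 => //; exact: intT_cst. Qed.

Lemma L1_cabs f : L1 f -> intT (fun w => cabs (f w)).
Proof.
move=> f1; have [fr fi] := f1; apply: (le_intT _ (intTD (intT_norm fr) (intT_norm fi))).
- by apply: measR_cabs; exact: L1_meas.
- by apply: ae_circleW => w; rewrite ger0_norm ?cabs_ge0// cabs_le_ReIm.
Qed.

Lemma L1D f g : L1 f -> L1 g -> L1 (fun w => f w + g w).
Proof.
move=> [fr fi] [gr gi]; split.
- under eq_fun do rewrite cReD; exact: intTD.
- under eq_fun do rewrite cImD; exact: intTD.
Qed.
Lemma L1N f : L1 f -> L1 (fun w => - f w).
Proof.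
move=> [fr fi]; split.
- under eq_fun do rewrite cReN; exact: intTN.
- under eq_fun do rewrite cImN; exact: intTN.
Qed.
Lemma L1B f g : L1 f -> L1 g -> L1 (fun w => f w - g w).
Proof. by move=> f1 /L1N; exact: L1D. Qed.
Lemma L1J f : L1 f -> L1 (fun w => (f w)^*).
Proof.
move=> [fr fi]; split.
- by under eq_fun do rewrite cReJ.
- under eq_fun do rewrite cImJ; exact: intTN.
Qed.
Lemma L1_real u : intT u -> L1 (fun w => (u w)%:C).
Proof. by move=> iu; split=> //=; exact: intT_cst. Qed.
Lemma L1_cst c : L1 (fun=> c).
Proof. by split; exact: intT_cst. Qed.

Lemma L1M_bdd f g (M : R) : L1 f -> measurableT g -> ae_circle (fun w => cabs (g w) <= M) ->
  L1 (fun w => g w * f w).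
Proof.
move=> f1 mg gM; apply: (@le_L1 _ (fun w => M * cabs (f w))).
- by apply: measurableTM => //; exact: L1_meas.
- by apply: intTZ; exact: L1_cabs.
- by apply: ae_circleS gM => w h; rewrite cabsM ler_wpM2r// cabs_ge0.
Qed.
Lemma L1Z c f : L1 f -> L1 (fun w => c * f w).
Proof.
move=> f1; apply: (@L1M_bdd f (fun=> c) (cabs c)) => //; exact: ae_circleW.
Qed.

Lemma integralTE f :
  integralT f = (avg (fun w => complex.Re (f w))) +i* (avg (fun w => complex.Im (f w))).
Proof. by apply: eq_ReIm; rewrite /integralT /avg /= ?mul0r ?subr0 ?addr0. Qed.

Lemma Re_integralT f : complex.Re (integralT f) = avg (fun w => complex.Re (f w)).
Proof. by rewrite integralTE. Qed.
Lemma Im_integralT f : complex.Im (integralT f) = avg (fun w => complex.Im (f w)).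
Proof. by rewrite integralTE. Qed.

Lemma integralTD f g : L1 f -> L1 g ->
  integralT (fun w => f w + g w) = integralT f + integralT g.
Proof.
move=> [fr fi] [gr gi]; apply: eq_ReIm; rewrite ?(cReD, cImD) !(Re_integralT, Im_integralT).
- by rewrite -avgD//; congr avg; apply/funext => w; rewrite cReD.
- by rewrite -avgD//; congr avg; apply/funext => w; rewrite cImD.
Qed.
Lemma integralTN f : L1 f -> integralT (fun w => - f w) = - integralT f.
Proof.
move=> [fr fi]; apply: eq_ReIm; rewrite ?(cReN, cImN) !(Re_integralT, Im_integralT).
- by rewrite -avgN//; congr avg; apply/funext => w; rewrite cReN.
- by rewrite -avgN//; congr avg; apply/funext => w; rewrite cImN.
Qed.
Lemma integralTB f g : L1 f -> L1 g ->
  integralT (fun w => f w - g w) = integralT f - integralT g.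
Proof. by move=> f1 g1; rewrite integralTD ?integralTN//; exact: L1N. Qed.
Lemma integralTZ c f : L1 f -> integralT (fun w => c * f w) = c * integralT f.
Proof.
move=> [fr fi]; apply: eq_ReIm; rewrite (cReM c, cImM c) !(Re_integralT, Im_integralT).
- rewrite -!avgZ// -avgB; [|exact: intTZ..].
  by congr avg; apply/funext => w; rewrite cReM.
- rewrite -!avgZ// -avgD; [|exact: intTZ..].
  by congr avg; apply/funext => w; rewrite cImM.
Qed.
Lemma integralTJ f : L1 f -> integralT (fun w => (f w)^*) = (integralT f)^*.
Proof.
move=> [fr fi]; apply: eq_ReIm; rewrite ?(cReJ, cImJ) !(Re_integralT, Im_integralT).
- by congr avg; apply/funext => w; rewrite cReJ.
- by rewrite -avgN//; congr avg; apply/funext => w; rewrite cImJ.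
Qed.
Lemma integralT_cst c : integralT (fun=> c) = c.
Proof. by rewrite integralTE !avg_cst; case: c. Qed.
Lemma integralT_real u : integralT (fun w => (u w)%:C) = (avg u)%:C.
Proof. by rewrite integralTE /= avg_cst. Qed.

Lemma eq_integralT_ae f g : measurableT f -> measurableT g ->
  ae_circle (fun w => f w = g w) -> integralT f = integralT g.
Proof.
move=> [fr fi] [gr gi] fg; rewrite !integralTE; congr (_ +i* _).
- by apply: eq_avg_ae => //; apply: ae_circleS fg => w ->.
- by apply: eq_avg_ae => //; apply: ae_circleS fg => w ->.
Qed.

(** Rotate the integral onto the positive real axis, where it is the integral
    of a real part. *)
Lemma cabs_integralT_le f : L1 f -> cabs (integralT f) <= avg (fun w => cabs (f w)).
Proof.
move=> f1; set I := integralT f.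
have [->|I0] := eqVneq I 0; first by rewrite cabs0 avg_ge0// => w; exact: cabs_ge0.
have I0' : 0 < cabs I by rewrite cabs_gt0.
(* the rotation is the multiplication by conj I / |I| *)
have ci : cabs (I^* / (cabs I)%:C) = 1.
  by rewrite cabsM cabsV cabsJ cabsR ger0_norm ?cabs_ge0// mulfV// gt_eqF.
have -> : cabs I = avg (fun w => complex.Re ((I^* / (cabs I)%:C) * f w)).
  rewrite -Re_integralT integralTZ// -/I mulrAC [I^* * I]mulrC mulcJ.
  rewrite -(fmorphV (real_complex R)) -(rmorphM (real_complex R)) /=.
  by rewrite expr2 mulfK// gt_eqF.
apply: le_avg; [by case: (L1Z (I^* / (cabs I)%:C) f1)|exact: L1_cabs|] => w.
by rewrite (le_trans (ler_norm _))// (le_trans (Re_le_cabs _))// cabsM ci mul1r.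
Qed.

Lemma integralT_dominated (f_ : nat -> T -> C) f u :
  (forall n, measurableT (f_ n)) -> measurableT f -> intT u ->
  ae_circle (fun w => ((f_ n w : C^o) @[n --> \oo] --> (f w : C^o))) ->
  (forall n, ae_circle (fun w => cabs (f_ n w) <= u w)) ->
  (integralT (f_ n) : C^o) @[n --> \oo] --> (integralT f : C^o).
Proof.
move=> mf_ mf iu ff fu; apply: cvgC_ReIm.
- under eq_fun do rewrite Re_integralT; rewrite Re_integralT.
  apply: (avg_dominated (g := u) _ _ _ _ _).2 => //.
  + by move=> n; exact: measR_Re.
  + exact: measR_Re.
  + by apply: ae_circleS ff => w; exact: cvgC_Re.
  + by move=> n; apply: ae_circleS (fu n) => w; apply: le_trans; exact: Re_le_cabs.
- under eq_fun do rewrite Im_integralT; rewrite Im_integralT.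
  apply: (avg_dominated (g := u) _ _ _ _ _).2 => //.
  + by move=> n; exact: measR_Im.
  + exact: measR_Im.
  + by apply: ae_circleS ff => w; exact: cvgC_Im.
  + by move=> n; apply: ae_circleS (fu n) => w; apply: le_trans; exact: Im_le_cabs.
Qed.

Lemma L2P f : L2 f <-> measurableT f /\ intT (fun w => cabs (f w) ^+ 2).
Proof.
split=> [[mf fy]|[mf /intTP[_ fy]]]; split=> //.
- apply/intTP; split; first exact: measR_cabs_sqr.
  by under eq_integral do rewrite ger0_norm ?sqr_ge0//.
- move: fy; under eq_integral do rewrite ger0_norm ?sqr_ge0//.
  by [].
Qed.

Lemma le_L2 f u : measurableT f -> intT u -> ae_circle (fun w => cabs (f w) ^+ 2 <= u w) -> L2 f.
Proof.
move=> mf iu fu; apply/L2P; split => //; apply: (le_intT _ iu).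
  exact: measR_cabs_sqr.
by apply: ae_circleS fu => w; rewrite ger0_norm ?sqr_ge0.
Qed.

Lemma sqr_cabsD_le (a b : C) : cabs (a + b) ^+ 2 <= 2 * cabs a ^+ 2 + 2 * cabs b ^+ 2.
Proof.
have : cabs (a + b) ^+ 2 <= (cabs a + cabs b) ^+ 2.
  by rewrite ler_pXn2r// ?nnegrE ?addr_ge0 ?cabs_ge0// le_cabsD.
have := sqr_ge0 (cabs a - cabs b).
rewrite !sqrrD !sqrrN; nra.
Qed.

Lemma L2D f g : L2 f -> L2 g -> L2 (fun w => f w + g w).
Proof.
move=> /L2P[mf if_] /L2P[mg ig].
apply: (@le_L2 _ (fun w => 2 * cabs (f w) ^+ 2 + 2 * cabs (g w) ^+ 2)).
- exact: measurableTD.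
- by apply: intTD; exact: intTZ.
- by apply: ae_circleW => w; exact: sqr_cabsD_le.
Qed.

Lemma L2_bddM f g (M : R) : L2 f -> measurableT g -> ae_circle (fun w => cabs (g w) <= M) ->
  L2 (fun w => g w * f w).
Proof.
move=> /L2P[mf if_] mg gM; apply: (@le_L2 _ (fun w => M ^+ 2 * cabs (f w) ^+ 2)).
- exact: measurableTM.
- exact: intTZ.
- apply: ae_circleS gM => w h; rewrite cabsM exprMn ler_wpM2r ?sqr_ge0//.
  by rewrite ler_pXn2r// ?nnegrE ?cabs_ge0// (le_trans _ h)// cabs_ge0.
Qed.

Lemma L2Z c f : L2 f -> L2 (fun w => c * f w).
Proof.
move=> f2; apply: (@L2_bddM f (fun=> c) (cabs c)) => //.
exact: ae_circleW.
Qed.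

Lemma L2N f : L2 f -> L2 (fun w => - f w).
Proof. by move=> /(L2Z (-1)); under eq_fun do rewrite mulN1r. Qed.

Lemma L2B f g : L2 f -> L2 g -> L2 (fun w => f w - g w).
Proof. by move=> f2 /L2N; exact: L2D. Qed.

Lemma L2J f : L2 f -> L2 (fun w => (f w)^*).
Proof.
move=> /L2P[mf if_]; apply/L2P; split; first exact: measurableTJ.
by under eq_fun do rewrite cabsJ.
Qed.

Lemma L2_cst c : L2 (fun=> c).
Proof. by apply/L2P; split; [exact: measurableT_cst|exact: intT_cst]. Qed.

Lemma L2M f g : L2 f -> L2 g -> L1 (fun w => f w * g w).
Proof.
move=> /L2P[mf if_] /L2P[mg ig].
apply: (@le_L1 _ (fun w => cabs (f w) ^+ 2 + cabs (g w) ^+ 2)).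
- exact: measurableTM.
- exact: intTD.
- apply: ae_circleW => w; rewrite cabsM.
  have := sqr_ge0 (cabs (f w) - cabs (g w)); have := cabs_ge0 (f w); have := cabs_ge0 (g w).
  rewrite sqrrD sqrrN; nra.
Qed.

Lemma inner_prodDl f1 f2 g : L2 f1 -> L2 f2 -> L2 g ->
  inner_prod (fun w => f1 w + f2 w) g = inner_prod f1 g + inner_prod f2 g.
Proof.
move=> h1 h2 /L2J hg; rewrite /inner_prod -integralTD; [|exact: L2M..].
by congr integralT; apply/funext => w; rewrite mulrDl.
Qed.

Lemma inner_prodNl f g : L2 f -> L2 g ->
  inner_prod (fun w => - f w) g = - inner_prod f g.
Proof.
move=> h1 /L2J hg; rewrite /inner_prod -integralTN; last exact: L2M.
by congr integralT; apply/funext => w; rewrite mulNr.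
Qed.

Lemma inner_prodBl f1 f2 g : L2 f1 -> L2 f2 -> L2 g ->
  inner_prod (fun w => f1 w - f2 w) g = inner_prod f1 g - inner_prod f2 g.
Proof. by move=> h1 h2 hg; rewrite inner_prodDl ?inner_prodNl//; exact: L2N. Qed.

Lemma inner_prodC f g : L2 f -> L2 g -> inner_prod g f = (inner_prod f g)^*.
Proof.
move=> h1 h2; rewrite /inner_prod -integralTJ; last by apply: L2M => //; exact: L2J.
by congr integralT; apply/funext => w; rewrite conjcM conjCK mulrC.
Qed.

Lemma eq_inner_prod f1 f2 g : measurableT f1 -> measurableT f2 -> measurableT g ->
  ae_eqT f1 f2 -> inner_prod f1 g = inner_prod f2 g.
Proof.
move=> m1 m2 mg f12; apply: eq_integralT_ae.
- by apply: measurableTM => //; exact: measurableTJ.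
- by apply: measurableTM => //; exact: measurableTJ.
- by apply: ae_circleS f12 => w ->.
Qed.

Lemma inner_prod_self0 f : L2 f -> inner_prod f f = 0 -> ae_circle (fun w => f w = 0).
Proof.
move=> /L2P[mf if_] /(congr1 (@complex.Re R)).
rewrite Re_integralT.
have -> : (fun w => complex.Re (f w * (f w)^*)) = fun w => cabs (f w) ^+ 2.
  by apply/funext => w; rewrite mulcJ.
rewrite /avg => /eqP; rewrite mulf_eq0 invr_eq0 gt_eqF ?twopi_gt0//= => /eqP i0.
have mf2 : measurable_fun (T := g_sigma_algebraType R.-ocitv.-measurable) period
    (fun t => (cabs (f (circ t)) ^+ 2)%:E).
  by apply/measurable_EFinP; exact: measR_cabs_sqr.
have /(ae_eq_integral_abs _ (@measurable_period R) mf2) :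
    (\int[mu]_(t in period) `|(cabs (f (circ t)) ^+ 2)%:E| = 0)%E.
  rewrite -[0%E]/(0%:E) -i0 /Rintegral fineK; last exact: (integrable_fin_num (@measurable_period R) if_).
  by apply: eq_integral => t _; rewrite gee0_abs ?lee_fin ?sqr_ge0//.
move=> h; have {}h : ae_circle (fun w => (cabs (f w) ^+ 2)%:E = 0%E) by exact: h.
apply: ae_circleS h => w [] /eqP; rewrite sqrf_eq0 cabs_eq0 => /eqP; exact.
Qed.

End ComplexCircleIntegral.

(** * Integrals of powers on the circle *)

Section CirclePowers.
Context {R : realType}.
Local Notation C := R[i].
Local Notation T := (circle R).
Local Notation mu := (@lebesgue_measure R).
Local Notation period := (@period R).

Lemma cabs_circle (w : T) : cabs (val w) = 1.
Proof. exact/eqP/(valP w). Qed.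

Lemma circle_neq0 (w : T) : val w != 0 :> C.
Proof. by rewrite -cabs_gt0 cabs_circle. Qed.

Lemma circ_expn (t : R) n : val (circ t) ^+ n = cos (t *+ n) +i* sin (t *+ n) :> C.
Proof.
elim: n => [|n IH]; first by rewrite !mulr0n cos0 sin0.
rewrite exprS IH !mulrS cosD sinD; apply: eq_ReIm; rewrite /= ; ring.
Qed.

Lemma integral_period_derive (F f : R -> R) : continuous f ->
  (forall t : R, is_derive t 1 F (f t)) ->
  \int[mu]_(t in period) f t = F (2 * pi) - F 0.
Proof.
move=> cf dF; have cF : continuous F.
  by move=> t; apply: differentiable_continuous; apply/derivable1_diffP; exact: ex_derive.
rewrite /Rintegral /period (@continuous_FTC2 _ _ F)//.
- exact: twopi_gt0.
- exact: continuous_subspaceT.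
- split; first by move=> t _; exact: ex_derive.
  + by apply: cvg_at_right_filter; exact: cF.
  + by apply: cvg_at_left_filter; exact: cF.
- by move=> t _; rewrite derive1E derive_val.
Qed.

Lemma is_derive_sinM (a t : R) : is_derive t 1 (fun t => sin (a * t)) (a * cos (a * t)).
Proof.
have dn : is_derive t 1 (fun t : R => a * t) a.
  by apply: is_derive_eq; rewrite ?scaler0 ?addr0 ?add0r /GRing.scale/= ?mulr1.
by apply: is_derive_eq (is_derive1_comp (is_derive_sin (a * t)) dn) _; rewrite mulrC.
Qed.

Lemma is_derive_cosM (a t : R) : is_derive t 1 (fun t => cos (a * t)) (a * - sin (a * t)).
Proof.
have dn : is_derive t 1 (fun t : R => a * t) a.
  by apply: is_derive_eq; rewrite ?scaler0 ?addr0 ?add0r /GRing.scale/= ?mulr1.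
by apply: is_derive_eq (is_derive1_comp (is_derive_cos (a * t)) dn) _; rewrite mulrC.
Qed.

Lemma continuous_mull (a : R) : continuous (fun t : R => a * t).
Proof. by move=> t; apply: cvgMr; exact: cvg_id. Qed.

(** An antiderivative of t |-> exp (i n t) is periodic. *)
Lemma integralT_pow n : (0 < n)%N -> integralT (fun w => val w ^+ n) = 0 :> C.
Proof.
move=> n0; have n0' : (n%:R : R) != 0 by rewrite pnatr_eq0 -lt0n.
have s2 : sin (n%:R * (2 * pi)) = 0 :> R.
  rewrite (_ : n%:R * (2 * pi) = 0 + pi *+ 2 *+ n) ?(periodicn (@sinD2pi R)) ?sin0//.
  by rewrite add0r -[RHS]mulr_natl -[pi *+ 2]mulr_natl.
have c2 : cos (n%:R * (2 * pi)) = 1 :> R.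
  rewrite (_ : n%:R * (2 * pi) = 0 + pi *+ 2 *+ n) ?(periodicn (@cosD2pi R)) ?cos0//.
  by rewrite add0r -[RHS]mulr_natl -[pi *+ 2]mulr_natl.
rewrite integralTE; apply: eq_ReIm => /=; apply/eqP; rewrite mulf_eq0; apply/orP; right; apply/eqP.
- under eq_Rintegral do rewrite circ_expn /= -mulr_natl.
  have cf : continuous (fun t : R => cos (n%:R * t)).
    by move=> t; apply: continuous_comp; [exact: continuous_mull|exact: continuous_cos].
  have dF (t : R) : is_derive t 1 (fun t : R => n%:R^-1 * sin (n%:R * t)) (cos (n%:R * t)).
    have h := @is_deriveZ R R R _ n%:R^-1 _ _ _ (is_derive_sinM n%:R t).
    by apply: is_derive_eq h _; rewrite /GRing.scale /= mulKf.
  by rewrite (integral_period_derive cf dF) s2 !mulr0 sin0 mulr0 subr0.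
- under eq_Rintegral do rewrite circ_expn /= -mulr_natl.
  have cf : continuous (fun t : R => sin (n%:R * t)).
    by move=> t; apply: continuous_comp; [exact: continuous_mull|exact: continuous_sin].
  have dF (t : R) : is_derive t 1 (fun t : R => - n%:R^-1 * cos (n%:R * t)) (sin (n%:R * t)).
    have h := @is_deriveZ R R R _ (- n%:R^-1) _ _ _ (is_derive_cosM n%:R t).
    by apply: is_derive_eq h _; rewrite /GRing.scale /= !mulrN mulNr opprK mulKf.
  by rewrite (integral_period_derive cf dF) c2 !mulr0 cos0 subrr.
Qed.

End CirclePowers.

(** * Herglotz integrals *)

Section Herglotz.
Context {R : realType}.
Local Notation C := R[i].
Local Notation T := (circle R).
Implicit Types (f g : T -> C) (z : C).

(** With kernel (w + z) / (w - z), as in the definition of outer functions; its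
    real part, for a real function, is the Poisson integral. *)
Definition herglotz f z : C := integralT (fun w => (val w + z) / (val w - z) * f w).

(** The j-th Fourier coefficient: w^-1 is the conjugate of w on the circle. *)
Definition moment f (j : nat) : C := integralT (fun w => (val w)^-1 ^+ j * f w).

Lemma circle_sub_ge (w : T) z : 1 - cabs z <= cabs (val w - z).
Proof. by have := lerB_cabs (val w) z; rewrite cabs_circle. Qed.

Lemma circle_sub_neq0 (w : T) z : cabs z < 1 -> val w - z != 0 :> C.
Proof. by move=> z1; rewrite -cabs_gt0 (lt_le_trans _ (circle_sub_ge w z))// subr_gt0. Qed.

Lemma cabs_inv_circle_sub (w : T) z (r : R) : r < 1 -> cabs z <= r ->
  cabs (val w - z)^-1 <= (1 - r)^-1.
Proof.
move=> r1 zr; rewrite cabsV lef_pV2 ?posrE ?subr_gt0//.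
  by rewrite (le_trans _ (circle_sub_ge w z))// lerB.
by rewrite cabs_gt0 circle_sub_neq0// (le_lt_trans zr).
Qed.

Lemma measurableT_val : measurableT (fun w : T => val w : C).
Proof. exact: measurableT_zfun. Qed.

Lemma measurableT_inv_sub z : cabs z < 1 -> measurableT (fun w : T => (val w - z)^-1 : C).
Proof.
move=> z1; apply: measurableTV => [|w]; last exact: circle_sub_neq0.
by apply: measurableTB; [exact: measurableT_val|exact: measurableT_cst].
Qed.

Lemma measurableT_inv : measurableT (fun w : T => (val w)^-1 : C).
Proof. by apply: measurableTV => [|w]; [exact: measurableT_val|exact: circle_neq0]. Qed.

Lemma measurableT_hker z : cabs z < 1 ->
  measurableT (fun w : T => (val w + z) / (val w - z) : C).
Proof.
move=> z1; apply: measurableTM; last exact: measurableT_inv_sub.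
by apply: measurableTD; [exact: measurableT_val|exact: measurableT_cst].
Qed.

Lemma cabs_hker z (w : T) : cabs z < 1 ->
  cabs ((val w + z) / (val w - z)) <= 2 / (1 - cabs z).
Proof.
move=> z1; rewrite cabsM ler_pM ?cabs_ge0//; last exact: cabs_inv_circle_sub.
by rewrite (le_trans (le_cabsD _ _))// cabs_circle; move: z1; lra.
Qed.

Lemma L1_hkerM f z : L1 f -> cabs z < 1 -> L1 (fun w => (val w + z) / (val w - z) * f w).
Proof.
move=> f1 z1; apply: (L1M_bdd (M := 2 / (1 - cabs z)) f1).
- exact: measurableT_hker.
- by apply: ae_circleW => w; exact: cabs_hker.
Qed.

(** Differentiation under the integral: the second-order remainder of the
    kernel is 2 w h^2 / ((w - z)^2 (w - z - h)), uniformly O(h^2). *)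
Lemma cderiv_herglotz f z : L1 f -> cabs z < 1 -> exists d, cderiv (herglotz f) z d.
Proof.
move=> f1 z1; set r := 1 - cabs z; have r0 : 0 < r by rewrite subr_gt0.
pose D (w : T) := 2 * val w * (val w - z)^-1 ^+ 2 : C.
have mD : measurableT D.
  apply: measurableTM; last by apply: measurableTX; exact: measurableT_inv_sub.
  by apply: measurableTM; [exact: measurableT_cst|exact: measurableT_val].
have iv (w : T) : cabs (val w - z)^-1 <= r^-1 by exact: cabs_inv_circle_sub.
have DM (w : T) : cabs (D w) <= 2 * r^-1 ^+ 2.
  rewrite /D cabsM (cabsM 2) cabs_circle mulr1 cabs_nat cabsX ler_wpM2l//.
  by rewrite ler_pXn2r// ?nnegrE ?cabs_ge0// invr_ge0 ltW.
have D1 : L1 (fun w => D w * f w).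
  by apply: (L1M_bdd f1 mD (M := 2 * r^-1 ^+ 2)); exact: ae_circleW.
exists (integralT (fun w => D w * f w)) => e e0.
set A := avg (fun w => cabs (f w)).
have A0 : 0 <= A by apply: avg_ge0 => w; exact: cabs_ge0.
pose k := 4 * r^-1 ^+ 3; have k0 : 0 <= k by rewrite mulr_ge0// exprn_ge0// invr_ge0 ltW.
pose K := k * A.
have K0 : 0 <= K by rewrite mulr_ge0.
exists (Num.min (r / 2) (e / (1 + K))).
  by rewrite lt_min !divr_gt0// ltr_pwDl.
move=> h; rewrite lt_min => /andP[hr he].
have zh : cabs (z + h) <= 1 - r / 2.
  rewrite (le_trans (le_cabsD _ _))// /r; move: hr; rewrite /r; lra.
have zh1 : cabs (z + h) < 1 by rewrite (le_lt_trans zh)// ltrBlDr ltrDl divr_gt0.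
rewrite [X in cabs (_ - _ - X)]mulrC.
rewrite -(integralTZ h D1) -!integralTB; [|try exact: L1_hkerM..]; last 2 first.
- by apply: L1B; exact: L1_hkerM.
- exact: L1Z.
have L : L1 (fun w => (val w + (z + h)) / (val w - (z + h)) * f w -
   (val w + z) / (val w - z) * f w - h * (D w * f w)).
  by apply: L1B; [apply: L1B; exact: L1_hkerM|exact: L1Z].
apply: le_trans (cabs_integralT_le L) _.
apply: (@le_trans _ _ (avg (fun w => k * cabs h ^+ 2 * cabs (f w)))).
  apply: le_avg; [exact: L1_cabs|by apply: intTZ; exact: L1_cabs|] => w.
  have wz := circle_sub_neq0 w z1; have wzh := circle_sub_neq0 w zh1.
  have -> : (val w + (z + h)) / (val w - (z + h)) * f w - (val w + z) / (val w - z) * f w -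
      h * (D w * f w) =
      2 * val w * h ^+ 2 * ((val w - z)^-1 ^+ 2 * (val w - (z + h))^-1) * f w.
    by rewrite /D; field; rewrite wz wzh.
  rewrite cabsM ler_wpM2r ?cabs_ge0// (cabsM (2 * _ * _)) (cabsM (2 * _)) (cabsM 2).
  rewrite (cabsM (_ ^+ 2)) cabs_circle mulr1 cabs_nat !cabsX.
  rewrite mulrAC ler_wpM2r ?sqr_ge0//.
  have -> : k = 2 * (r^-1 ^+ 2 * (2 / r)) by rewrite /k; field; rewrite gt_eqF.
  rewrite ler_wpM2l// ler_pM ?exprn_ge0 ?cabs_ge0//.
    by rewrite ler_pXn2r// ?nnegrE ?cabs_ge0// invr_ge0 ltW.
  rewrite (le_trans (cabs_inv_circle_sub w _ zh))//; first by rewrite ltrBlDr ltrDl divr_gt0.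
  by rewrite opprB addrCA subrr addr0 invf_div.
rewrite avgZ; last exact: L1_cabs.
rewrite -/A mulrAC -/K expr2 mulrA ler_wpM2r ?cabs_ge0//.
apply: (@le_trans _ _ (K * (e / (1 + K)))); first by rewrite ler_wpM2l// ltW.
rewrite mulrCA ler_piMr//; first exact: ltW.
by rewrite ler_pdivrMr ?ltr_pwDl// mul1r lerDr.
Qed.

(** The remainder of order N in the geometric expansion of
    (w + z) / (w - z) = 2 / (1 - z / w) - 1. *)
Definition herglotz_rem f N z : C :=
  integralT (fun w => 2 * (z / val w) ^+ N * (val w / (val w - z)) * f w).

Lemma L1_invXM f j : L1 f -> L1 (fun w => (val w)^-1 ^+ j * f w).
Proof.
move=> f1; apply: (L1M_bdd (M := 1) f1).
- by apply: measurableTX; exact: measurableT_inv.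
- by apply: ae_circleW => w; rewrite cabsX cabsV cabs_circle invr1 expr1n.
Qed.

Lemma L1_rem f N z : L1 f -> cabs z < 1 ->
  L1 (fun w => 2 * (z / val w) ^+ N * (val w / (val w - z)) * f w).
Proof.
move=> f1 z1; apply: (L1M_bdd (M := 2 * cabs z ^+ N * (1 - cabs z)^-1) f1).
- apply: measurableTM; last by apply: measurableTM; [exact: measurableT_val|exact: measurableT_inv_sub].
  apply: measurableTM; first exact: measurableT_cst.
  apply: measurableTX; apply: measurableTM; [exact: measurableT_cst|exact: measurableT_inv].
- apply: ae_circleW => w; rewrite !cabsM cabs_nat cabsX cabsM cabs_circle mul1r.
  rewrite (cabsV (val w)) cabs_circle invr1 mulr1 ler_wpM2l ?mulr_ge0 ?exprn_ge0 ?cabs_ge0//.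
  exact: cabs_inv_circle_sub.
Qed.

Lemma cabs_herglotz_rem f N z (r : R) : L1 f -> r < 1 -> cabs z <= r ->
  cabs (herglotz_rem f N z) <= 2 * r ^+ N * (1 - r)^-1 * avg (fun w => cabs (f w)).
Proof.
move=> f1 r1 zr; have z1 := le_lt_trans zr r1.
have r0 : 0 <= r := le_trans (cabs_ge0 z) zr.
apply: le_trans (cabs_integralT_le (L1_rem N f1 z1)) _.
rewrite -avgZ; last exact: L1_cabs.
apply: le_avg; [by apply: L1_cabs; exact: L1_rem|by apply: intTZ; exact: L1_cabs|] => w.
rewrite cabsM ler_wpM2r ?cabs_ge0// !cabsM cabs_nat cabsX cabsM cabs_circle mul1r.
rewrite (cabsV (val w)) cabs_circle invr1 mulr1 ler_pM ?mulr_ge0 ?exprn_ge0 ?cabs_ge0//.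
  by rewrite ler_wpM2l// lerXn2r// nnegrE cabs_ge0.
exact: cabs_inv_circle_sub.
Qed.

Lemma herglotz_expansion f N z : L1 f -> cabs z < 1 ->
  herglotz f z = 2 * \sum_(j < N) moment f j * z ^+ j - moment f 0 + herglotz_rem f N z.
Proof.
move=> f1 z1; elim: N => [|N ->].
  rewrite big_ord0 mulr0 add0r /herglotz_rem /moment addrC -integralTB.
  - congr integralT; apply/funext => w; have := circle_sub_neq0 w z1.
    by rewrite !expr0 => wz; field.
  - exact: L1_rem.
  - exact: L1_invXM.
have -> : herglotz_rem f N z = 2 * z ^+ N * moment f N + herglotz_rem f N.+1 z.
  rewrite /moment -integralTZ; last exact: L1_invXM.
  rewrite -integralTD; [|by apply: L1Z; exact: L1_invXM|exact: L1_rem].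
  congr integralT; apply/funext => w; have wz := circle_sub_neq0 w z1.
  have w0 := circle_neq0 w; rewrite !exprMn !exprVn !exprSr.
  by field; rewrite wz w0 expf_neq0.
by rewrite big_ord_recr /=; ring.
Qed.

End Herglotz.

(** * Polynomial approximation and the mean value property *)

Section MeanValue.
Context {R : realType}.
Local Notation C := R[i].
Local Notation T := (circle R).
Implicit Types (f g : T -> C) (z a b : C).

Lemma eq_le_refl (x y : R) : x = y -> x <= y.
Proof. by move=> ->. Qed.

Lemma geometric_small (r A e : R) : 0 <= r < 1 -> 0 < e -> exists N, r ^+ N.+1 * A <= e.
Proof.
move=> /andP[r0 r1] e0.
have : r ^+ n * A @[n --> \oo] --> 0 * A.
  by apply: cvgMl; apply: cvg_expr; rewrite ger0_norm.
rewrite mul0r => /cvgrPdist_le/(_ _ e0)[N _ /(_ N.+1)] /= h; exists N.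
by apply: le_trans (h (leqnSn N)); rewrite sub0r normrN ler_norm.
Qed.

Lemma cabs_le_eps a : (forall e : R, 0 < e -> cabs a <= e) -> a = 0.
Proof.
move=> h; apply/eqP; rewrite -cabs_eq0 eq_le cabs_ge0 andbT.
by apply/ler_addgt0Pl => e e0; rewrite addr0 h.
Qed.

(** In the expansion only the constant term 2 * moment f 0 - moment f 0 and the
    remainder are left, and the remainder tends to 0. *)
Lemma herglotz_const f z : L1 f -> (forall j, (0 < j)%N -> moment f j = 0) ->
  cabs z < 1 -> herglotz f z = integralT f.
Proof.
move=> f1 mf z1; apply/eqP; rewrite -subr_eq0; apply/eqP; apply: cabs_le_eps => e e0.
have [N hN] := @geometric_small (cabs z) (2 * (1 - cabs z)^-1 * avg (fun w => cabs (f w))) e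
  (introT andP (conj (cabs_ge0 z) z1)) e0.
rewrite (herglotz_expansion N.+1 f1 z1) big_ord_recl big1 => [|i _]; last first.
  by rewrite mf// mul0r.
have -> : moment f 0 = integralT f.
  by congr integralT; apply/funext => w; rewrite expr0 mul1r.
rewrite /= expr0 mulr1 addr0 (_ : _ - _ = herglotz_rem f N.+1 z); last by ring.
by apply: le_trans (cabs_herglotz_rem N.+1 f1 z1 (lexx _)) (le_trans _ hN); apply: eq_le_refl; ring.
Qed.

Lemma moment1 j : (0 < j)%N -> moment (fun=> 1 : C) j = 0.
Proof.
move=> j0; rewrite /moment.
have -> : (fun w : T => (val w)^-1 ^+ j * 1 : C) = fun w => (val w ^+ j)^*.
  by apply/funext => w; rewrite mulr1 invc_unit ?cabs_circle// conjcX.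
rewrite integralTJ ?integralT_pow ?conjC0//.
apply: (L1_bdd (M := 1)); first by apply: measurableTX; exact: measurableT_val.
by apply: ae_circleW => w; rewrite cabsX cabs_circle expr1n.
Qed.

Lemma herglotz1 z : cabs z < 1 -> herglotz (fun=> 1) z = 1.
Proof.
move=> z1; rewrite herglotz_const// ?integralT_cst//; first exact: L1_cst.
exact: moment1.
Qed.

Lemma herglotz0 f : herglotz f 0 = integralT f.
Proof.
congr integralT; apply/funext => w.
by rewrite addr0 subr0 mulfV ?circle_neq0// mul1r.
Qed.

Lemma cabs_herglotz_le f z (r : R) : L1 f -> r < 1 -> cabs z <= r ->
  cabs (herglotz f z) <= 2 / (1 - r) * avg (fun w => cabs (f w)).
Proof.
move=> f1 r1 zr; have z1 := le_lt_trans zr r1.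
apply: le_trans (cabs_integralT_le (L1_hkerM f1 z1)) _.
rewrite -avgZ; last exact: L1_cabs.
apply: le_avg; [by apply: L1_cabs; exact: L1_hkerM|by apply: intTZ; exact: L1_cabs|] => w.
rewrite cabsM ler_wpM2r ?cabs_ge0// (le_trans (cabs_hker _ z1))//.
by rewrite ler_wpM2l// lef_pV2 ?posrE ?subr_gt0// lerB.
Qed.

Definition poly_approx (r : R) (F : C -> C) := forall e : R, 0 < e ->
  exists p : {poly C}, forall z, cabs z <= r -> cabs (F z - p.[z]) <= e.

Lemma poly_approx_herglotz f (r : R) : L1 f -> 0 <= r < 1 -> poly_approx r (herglotz f).
Proof.
move=> f1 r01 e e0; have /andP[r0 r1] := r01.
have [N hN] := @geometric_small r (2 * (1 - r)^-1 * avg (fun w => cabs (f w))) e r01 e0.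
exists (2%:P * \poly_(j < N.+1) moment f j - (moment f 0)%:P) => z zr.
have z1 := le_lt_trans zr r1.
rewrite (herglotz_expansion N.+1 f1 z1) !hornerE horner_poly addrAC subrr add0r.
by apply: le_trans (cabs_herglotz_rem N.+1 f1 r1 zr) (le_trans _ hN); apply: eq_le_refl; ring.
Qed.

Lemma poly_approxD r F G : poly_approx r F -> poly_approx r G ->
  poly_approx r (fun z => F z + G z).
Proof.
move=> hF hG e e0; have e2 : 0 < e / 2 by rewrite divr_gt0.
have [p hp] := hF _ e2; have [q hq] := hG _ e2; exists (p + q) => z zr.
rewrite hornerD opprD addrACA (splitr e) (le_trans (le_cabsD _ _))// lerD//.
- exact: hp.
- exact: hq.
Qed.

Lemma poly_approxZ r c F : poly_approx r F -> poly_approx r (fun z => c * F z).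
Proof.
move=> hF e e0; have c1 : 0 < 1 + cabs c by rewrite ltr_pwDl// cabs_ge0.
have [p hp] := hF _ (divr_gt0 e0 c1); exists (c *: p) => z zr.
rewrite hornerZ -mulrBr cabsM; apply: le_trans (ler_wpM2l (cabs_ge0 _) (hp z zr)) _.
by rewrite mulrA ler_pdivrMr// mulrC ler_wpM2l ?(ltW e0)// lerDr.
Qed.

Lemma poly_approx_scale r (s : R) F : 0 <= s <= 1 -> poly_approx r F ->
  poly_approx r (fun z => F (s%:C * z)).
Proof.
move=> /andP[s0 s1] hF e e0; have [p hp] := hF _ e0.
exists (p \Po (s%:C *: 'X)) => z zr; rewrite horner_comp hornerZ hornerX; apply: hp.
by rewrite cabsM cabsR ger0_norm// (le_trans _ zr)// ler_piMl// cabs_ge0.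
Qed.

Lemma cabs_subX_le a b (m : R) N : 1 <= m -> cabs a <= m -> cabs b <= m ->
  cabs (a ^+ N - b ^+ N) <= N%:R * m ^+ N * cabs (a - b).
Proof.
move=> m1 am bm; have m0 := le_trans ler01 m1.
elim: N => [|N IH]; first by rewrite !expr0 subrr cabs0 mul0r mul0r.
have -> : a ^+ N.+1 - b ^+ N.+1 = a * (a ^+ N - b ^+ N) + (a - b) * b ^+ N.
  by rewrite !exprS; ring.
have h1 : cabs (a * (a ^+ N - b ^+ N)) <= m * (N%:R * m ^+ N * cabs (a - b)).
  by rewrite cabsM ler_pM ?cabs_ge0.
have h2 : cabs ((a - b) * b ^+ N) <= m ^+ N.+1 * cabs (a - b).
  rewrite cabsM mulrC ler_wpM2r ?cabs_ge0// cabsX exprS.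
  apply: (@le_trans _ _ (m ^+ N)); first by rewrite lerXn2r// nnegrE cabs_ge0.
  by rewrite ler_peMl// exprn_ge0.
apply: le_trans (le_cabsD _ _) _; apply: le_trans (lerD h1 h2) _.
by rewrite -[N.+1%:R]natr1 exprS; apply: eq_le_refl; ring.
Qed.

(** cexp a is the power of order n of cexp (a / n), which differs from 1 + a / n
    by o(1 / n); both are bounded by exp (B / n), so the powers differ by o(1). *)
Lemma cexp_euler (B e : R) : 0 < B -> 0 < e -> exists N, forall a, cabs a <= B ->
  cabs (cexp a - (1 + N.+1%:R^-1 * a) ^+ N.+1) <= e.
Proof.
move=> B0 e0; pose e1 := e / (expR B * B).
have e10 : 0 < e1 by rewrite divr_gt0// mulr_gt0// expR_gt0.
have [r r0 hr] := cderiv_cexp0 e10.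
have [N _ hN] : \forall n \near \oo, B / r <= n%:R.
  exact: nbhs_infty_ger.
exists N => a aB; set n := N.+1.
have n0 : 0 < n%:R :> R by rewrite ltr0n.
have n0' : (n%:R : C) != 0 by rewrite pnatr_eq0.
have Bn : B / n%:R < r.
  rewrite ltr_pdivrMr// mulrC -ltr_pdivrMr//; apply: le_lt_trans (hN N (leqnn _)) _.
  by rewrite ltr_nat.
pose h := n%:R^-1 * a.
have hB : cabs h <= B / n%:R by rewrite cabsM cabsV cabs_nat mulrC ler_wpM2r// invr_ge0 ltW.
have -> : cexp a = cexp h ^+ n.
  by rewrite -cexpMn -[h *+ n]mulr_natl /h mulrA mulfV// mul1r.
rewrite -/h.
have m1 : 1 <= expR (B / n%:R) by rewrite -expR0 ler_expR divr_ge0// ltW.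
have q1 : cabs (cexp h) <= expR (B / n%:R).
  by rewrite cabs_cexp ler_expR (le_trans (ler_norm _))// (le_trans (Re_le_cabs _)).
have q2 : cabs (1 + h) <= expR (B / n%:R).
  rewrite (le_trans (le_cabsD _ _))// cabs1 (le_trans _ (expR_ge1Dx _))// lerD2l//.
apply: le_trans (cabs_subX_le n m1 q1 q2) _.
have := hr h (le_lt_trans hB Bn); rewrite add0r cexp0 mul1r => hh.
have -> : cexp h - (1 + h) = cexp h - 1 - h by rewrite opprD addrA.
rewrite -expRM_natr divfK ?gt_eqF// mulrC.
apply: (@le_trans _ _ (e1 * (B / n%:R) * (n%:R * expR B))).
  apply: ler_wpM2r; first exact: mulr_ge0 (ltW n0) (expR_ge0 _).
  by apply: (le_trans hh); apply: ler_wpM2l hB; exact: ltW.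
by apply: eq_le_refl; rewrite /e1; field; rewrite !gt_eqF// expR_gt0.
Qed.

(** Replace F by a polynomial p, then cexp p by (1 + p / n)^n, which is a
    polynomial. *)
Lemma poly_approx_cexp r F (B : R) : (forall z, cabs z <= r -> cabs (F z) <= B) ->
  poly_approx r F -> poly_approx r (fun z => cexp (F z)).
Proof.
move=> FB hF e e0; pose B1 := `|B| + 1; have B10 : 0 < B1 by rewrite ltr_wpDl.
have e2 : 0 < e / 2 by rewrite divr_gt0.
have [s s0 hs] := cderiv_lip (@cderiv_cexp0 R).
pose d := Num.min (Num.min (s / 2) 1) (e / 4 / expR B1).
have d0 : 0 < d by rewrite /d !lt_min ltr01 !divr_gt0 ?expR_gt0.
have [ds [d1 de]] : d < s /\ d <= 1 /\ d <= e / 4 / expR B1.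
  have s2 : s / 2 < s by rewrite ltr_pdivrMr// ltr_pMr// ltr1n.
  split; first by rewrite (le_lt_trans _ s2)// /d !ge_min lexx.
  by split; rewrite /d !ge_min lexx ?orbT.
clearbody d.
have [p hp] := hF _ d0; have [N hN] := cexp_euler B10 e2.
exists ((1 + N.+1%:R^-1 *: p) ^+ N.+1) => z zr.
have pB : cabs p.[z] <= B1.
  have -> : p.[z] = F z - (F z - p.[z]) by rewrite opprB addrC subrK.
  rewrite (le_trans (le_cabsB _ _))// lerD ?(le_trans (hp z zr))//.
  by rewrite (le_trans (FB z zr))// ler_norm.
rewrite !hornerE.
have := hN _ pB; set X := (_ ^+ _) => hX.
rewrite -(subrK (cexp p.[z]) (cexp (F z))) -addrA (splitr e) (le_trans (le_cabsD _ _))// lerD//.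
have -> : cexp (F z) - cexp p.[z] = cexp p.[z] * (cexp (F z - p.[z]) - 1).
  by rewrite mulrBr mulr1 -cexpD [p.[z] + _]addrC subrK.
have := hs (F z - p.[z]) (le_lt_trans (hp z zr) ds); rewrite add0r cexp0 cabs1 => h1.
rewrite cabsM cabs_cexp.
apply: (@le_trans _ _ (expR B1 * (2 * (e / 4 / expR B1)))).
  rewrite ler_pM ?expR_ge0 ?cabs_ge0//.
    by rewrite ler_expR (le_trans (ler_norm _))// (le_trans (Re_le_cabs _)).
  apply: (le_trans h1); rewrite -[1 + 1]/(2%:R) ler_wpM2l// (le_trans (hp z zr))//.
by apply: eq_le_refl; field; rewrite !gt_eqF// expR_gt0.
Qed.

(** The factor w^n makes the induction on p = q X + c go through: X is absorbed
    into it. *)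
Lemma integralT_powM_poly (p : {poly C}) (r : R) n :
  L1 (fun w : T => val w ^+ n * p.[r%:C * val w]) /\
  integralT (fun w : T => val w ^+ n * p.[r%:C * val w]) = if n == 0%N then p.[0] else 0.
Proof.
have Lw m : L1 (fun w : T => val w ^+ m).
  apply: (L1_bdd (M := 1)); first by apply: measurableTX; exact: measurableT_val.
  by apply: ae_circleW => w; rewrite cabsX cabs_circle expr1n.
elim/poly_ind: p n => [|p c IH] n.
  rewrite (_ : (fun w : T => _) = fun=> 0); last by apply/funext => w; rewrite horner0 mulr0.
  by split; [exact: L1_cst|rewrite integralT_cst horner0 if_same].
have [Lp ip] := IH n.+1.
rewrite (_ : (fun w : T => _) = fun w => r%:C * (val w ^+ n.+1 * p.[r%:C * val w]) + c * val w ^+ n);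
  last by apply/funext => w; rewrite hornerMXaddC exprS; ring.
split; first by apply: L1D; exact: L1Z.
rewrite integralTD; [|exact: L1Z..].
rewrite !integralTZ// ip /= hornerMXaddC !mulr0 !add0r.
case: n {ip Lp} => [|n] /=; last by rewrite integralT_pow// mulr0.
by under eq_fun do rewrite expr0; rewrite integralT_cst mulr1.
Qed.

(** The mean value property holds for polynomials and passes to uniform
    limits. *)
Lemma poly_approx_mean (r : R) F : 0 <= r -> poly_approx r F ->
  L1 (fun w : T => F (r%:C * val w)) -> integralT (fun w : T => F (r%:C * val w)) = F 0.
Proof.
move=> r0 hF LF; apply/eqP; rewrite -subr_eq0; apply/eqP; apply: cabs_le_eps => e e0.
have [p hp] := hF (e / 2) (divr_gt0 e0 (ltr0n _ 2)).
have [Lp] := integralT_powM_poly p r 0; rewrite eqxx.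
have E : (fun w : T => val w ^+ 0 * p.[r%:C * val w]) = fun w => p.[r%:C * val w].
  by apply/funext => w; rewrite expr0 mul1r.
rewrite E in Lp *; move=> ip.
rewrite -(subrK p.[0] (integralT _)) -addrA -{1}ip -integralTB// (splitr e).
rewrite (le_trans (le_cabsD _ _))// lerD//.
  apply: le_trans (cabs_integralT_le (L1B LF Lp)) _.
  rewrite -(avg_cst (e / 2)); apply: le_avg; [by apply: L1_cabs; exact: L1B|exact: intT_cst|].
  by move=> w; apply: hp; rewrite cabsM cabs_circle mulr1 cabsR ger0_norm.
by rewrite cabs_distC; apply: hp; rewrite cabs0.
Qed.

End MeanValue.

(** * The Poisson kernel *)

Section PoissonKernel.
Context {R : realType}.
Local Notation C := R[i].
Local Notation T := (circle R).
Implicit Types (u : T -> R) (z : C) (w : T).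

Definition poisson_kernel z w : R := complex.Re ((val w + z) / (val w - z)).

Definition poisson u z : R := avg (fun w => poisson_kernel z w * u w).

Lemma poisson_kernelE z w : cabs z < 1 ->
  poisson_kernel z w = (1 - cabs z ^+ 2) / cabs (val w - z) ^+ 2.
Proof.
move=> z1; rewrite /poisson_kernel cReM cReV cImV.
have := cabs_circle w; move: (val w) => x /(congr1 (fun y => y ^+ 2)).
rewrite expr1n !cabs_sqr => <-; rewrite !(cReD, cImD, cReN, cImN) !mulrA -mulrBl.
by congr (_ * _); ring.
Qed.

Lemma poisson_kernel_ge0 z w : cabs z < 1 -> 0 <= poisson_kernel z w.
Proof.
move=> z1; rewrite poisson_kernelE// divr_ge0 ?sqr_ge0// subr_ge0.
by rewrite expr_le1 ?cabs_ge0// ltW.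
Qed.

Lemma measR_poisson_kernel z : cabs z < 1 -> measR (poisson_kernel z).
Proof. by move=> z1; apply: measR_Re; exact: measurableT_hker. Qed.

Lemma poisson_kernel_le z w : cabs z < 1 -> `|poisson_kernel z w| <= 2 / (1 - cabs z).
Proof. by move=> z1; rewrite (le_trans (Re_le_cabs _))// cabs_hker. Qed.

(** Real part of [herglotz1]. *)
Lemma avg_poisson_kernel z : cabs z < 1 -> avg (poisson_kernel z) = 1.
Proof.
move=> z1; have := congr1 (@complex.Re R) (herglotz1 z1).
rewrite Re_integralT /= => <-; congr avg; apply/funext => w.
by rewrite mulr1.
Qed.

Lemma intT_poisson u z : intT u -> cabs z < 1 -> intT (fun w => poisson_kernel z w * u w).
Proof.
move=> iu z1; apply: (le_intT _ (intTZ (2 / (1 - cabs z)) (intT_norm iu))).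
- by apply: measRM; [exact: measR_poisson_kernel|exact: intT_meas].
- by apply: ae_circleW => w; rewrite normrM ler_wpM2r// poisson_kernel_le.
Qed.

Lemma intT_poisson_kernel z : cabs z < 1 -> intT (poisson_kernel z).
Proof.
by move=> z1; have := intT_poisson (intT_cst 1) z1; under eq_fun do rewrite mulr1.
Qed.

Lemma Re_herglotz u z : complex.Re (herglotz (fun w => (u w)%:C) z) = poisson u z.
Proof.
rewrite Re_integralT; congr avg; apply/funext => w.
by rewrite cReM /= mulr0 subr0.
Qed.

Lemma poisson_le u z (M : R) : intT u -> ae_circle (fun w => u w <= M) -> cabs z < 1 ->
  poisson u z <= M.
Proof.
move=> iu uM z1; rewrite -[M]mulr1 -(avg_poisson_kernel z1) -avgZ; last first.
  exact: intT_poisson_kernel.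
apply: le_avg_ae; [exact: intT_poisson|by apply: intTZ; exact: intT_poisson_kernel|].
by apply: ae_circleS uM => w h; rewrite mulrC ler_wpM2r// poisson_kernel_ge0.
Qed.

(** The denominator of the Poisson kernel, by the law of cosines. *)
Lemma cabs_circ_sub_sqr (r s t : R) :
  cabs (val (circ s) - r%:C * val (circ t)) ^+ 2 =
  (1 - r) ^+ 2 + 2 * r * (1 - cos (s - t)).
Proof.
rewrite cabs_sqr /= !mul0r !subr0 ?addr0 cosB.
have := cos2Dsin2 s; have := cos2Dsin2 t => ht hs.
rewrite (_ : (1 - r) ^+ 2 = (cos s ^+ 2 + sin s ^+ 2) - 2 * r + r ^+ 2 * (cos t ^+ 2 + sin t ^+ 2)).
  by ring.
by rewrite hs ht; ring.
Qed.

End PoissonKernel.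

(** * Fatou's theorem *)

Section Fatou.
Context {R : realType}.
Local Notation mu := (@lebesgue_measure R).
Local Notation period := (@period R).

(** 1 - cos x = 2 sin^2 (x / 2), and |sin y| >= |y| / 2 near 0. *)
Lemma onem_cos_ge_near0 : exists2 h : R, 0 < h &
  forall x : R, `|x| < h -> x ^+ 2 / 8 <= 1 - cos x.
Proof.
have [h h0 hh] := is_derive0_le (is_derive_sin (0 : R)) (divr_gt0 ltr01 (ltr0n _ 2) : 0 < 1 / 2 :> R).
exists (2 * h) => [|x xh]; first by rewrite mulr_gt0.
set y := x / 2; have -> : x = y *+ 2 by rewrite -mulr_natr divfK.
have yh : `|y| < h by rewrite normrM (ger0_norm (_ : 0 <= 2^-1))// ltr_pdivrMr// mulrC.
have := hh y yh; rewrite sin0 cos0 subr0 mul1r => hs.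
rewrite cos_mulr2n -(mulr_natr (_ ^+ 2)) -mulr_natr.
have c2 := cos2Dsin2 y.
have : `|y| ^+ 2 <= 4 * sin y ^+ 2.
  have : `|y| <= 2 * `|sin y|.
    have := ler_normB (sin y) (sin y - y); rewrite opprB addrC subrK; lra.
  have := normr_ge0 y; rewrite -[sin y ^+ 2]real_normK ?num_real// => ? ?.
  have : `|y| ^+ 2 <= (2 * `|sin y|) ^+ 2 by rewrite lerXn2r// nnegrE.
  by rewrite exprMn; lra.
rewrite real_normK ?num_real//; lra.
Qed.

Lemma cos_le_cos_far (h x : R) : 0 < h < pi -> h <= `|x| -> `|x| <= 2 * pi - h -> cos x <= cos h.
Proof.
move=> /andP[h0 hpi] hx xh; rewrite -(cos_norm x).
have mono y : h <= y <= pi -> cos y <= cos h.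
  move=> /andP[hy ypi]; rewrite leNgt ltr_cos -?leNgt// in_itv/=.
    by rewrite (le_trans (ltW h0) hy).
  by rewrite !ltW.
have [xpi|xpi] := leP `|x| pi; first by rewrite mono// hx.
have -> : cos `|x| = cos (2 * pi - `|x|).
  by rewrite -cosN -[LHS]cosD2pi [X in cos X = _]addrC mulr_natl.
by apply: mono; apply/andP; split; lra.
Qed.

Lemma cos_lt1 (h : R) : 0 < h < pi -> cos h < 1.
Proof.
by move=> /andP[h0 hpi]; rewrite -cos0 ltr_cos// in_itv/= ?lexx ?pi_ge0// !ltW.
Qed.

(** A step function that dominates d / x^2 for d <= |x| < d 2^N, where
    x = s - t, and 1 / d for |x| < d; the weight 4^-j is the decay of d / x^2 on the
    j-th dyadic ring. *)
Definition dyadic_kernel (d t : R) (N : nat) (s : R) : R :=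
  \sum_(j < N.+1) 4 / d / 4 ^+ j * \1_(ball t (d * 2 ^+ j)) s.

Lemma dyadic_kernel_ge (d t K s : R) N : 0 < d -> 0 <= K -> K <= 2 / d ->
  K * (s - t) ^+ 2 <= 16 * d -> `|s - t| < d * 2 ^+ N ->
  K <= 16 * dyadic_kernel d t N s.
Proof.
move=> d0 K0 Kd Kx; rewrite /dyadic_kernel.
have ge0 j : 0 <= 4 / d / 4 ^+ j * \1_(ball t (d * 2 ^+ j)) s :> R.
  by rewrite mulr_ge0// ?indicE//= divr_ge0 ?exprn_ge0// divr_ge0// ltW.
have in1 j : `|s - t| < d * 2 ^+ j -> \1_(ball t (d * 2 ^+ j)) s = 1 :> R.
  by move=> h; rewrite indicE mem_set//= /ball /= distrC.
elim: N => [|N IH] xN.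
  rewrite big_ord_recl big_ord0 addr0 /= in1// expr0 divr1 mulr1.
  apply: (le_trans Kd); rewrite mulrA ler_wpM2r ?invr_ge0 ?ltW//; lra.
rewrite big_ord_recr /= mulrDr.
have [xN'|xN'] := ltP `|s - t| (d * 2 ^+ N).
  by rewrite (le_trans (IH xN'))// lerDl mulr_ge0.
rewrite in1// mulr1 ler_wpDl//.
  by rewrite mulr_ge0// sumr_ge0.
have x2 : d ^+ 2 * 4 ^+ N <= (s - t) ^+ 2.
  rewrite -[leRHS]real_normK ?num_real// (_ : _ * _ = (d * 2 ^+ N) ^+ 2).
    by rewrite lerXn2r// nnegrE mulr_ge0 ?exprn_ge0// ltW.
  have four : 4 = 2 ^+ 2 :> R by rewrite -natrX.
  by rewrite exprMn four -!exprM mulnC.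
have : K * (d ^+ 2 * 4 ^+ N) <= 16 * d by rewrite (le_trans _ Kx)// ler_wpM2l.
have e0 : 0 < d ^+ 2 * 4 ^+ N by rewrite mulr_gt0 ?exprn_gt0.
rewrite -ler_pdivlMr// => /le_trans; apply; apply: eq_le_refl.
have q0 : (4 : R) ^+ N != 0 by rewrite expf_neq0.
rewrite [4 ^+ N.+1]exprS; move: (4 ^+ N) q0 => q q0; field.
by rewrite q0 gt_eqF.
Qed.

Lemma integrable_indicM (f : R -> R) (t r : R) :
  mu.-integrable period (fun s => (f s)%:E) ->
  mu.-integrable period (fun s => (\1_(ball t r) s * f s)%:E).
Proof.
move=> fi; apply: (le_integrable (@measurable_period R) _ _ fi).
- have mf := (measurable_EFinP _ _).1 (measurable_int _ fi).
  apply/measurable_EFinP; apply: measurable_funM => //.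
  by apply: measurable_indic; exact: measurable_ball.
- move=> s _; rewrite !abse_EFin lee_fin normrM ler_piMl// indicE.
  by case: (_ \in _); rewrite ?normr1 ?normr0.
Qed.

Lemma integrable_dist (U : R -> R) (c : R) : mu.-integrable period (fun s => (U s)%:E) ->
  mu.-integrable period (fun s => (`|U s - c|)%:E).
Proof.
move=> iU; have h1 := integrableB (@measurable_period R) iU (intT_cst c).
exact: (integrable_norm h1).
Qed.

Lemma integral_ball_period_le (U : R -> R) (t r : R) :
  mu.-integrable period (fun s => (U s)%:E) -> period t ->
  (\int[mu]_(s in period) (\1_(ball t r) s * `|U s - U t|)%:E <=
   \int[mu]_(s in ball t r) `|(center ((U \_ period) t) \o (U \_ period)) s|%:E)%E.
Proof.
move=> iU pt; rewrite integral_mkcond [leRHS]integral_mkcond.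
have mU := (measurable_EFinP _ _).1 (measurable_int _ iU).
have mU' := (measurable_restrictT U (@measurable_period R)).1 mU.
apply: ge0_le_integral => //.
- by move=> s _; apply: erestrict_ge0 => x _; rewrite lee_fin mulr_ge0// indicE.
- have h := measurable_int _ (integrable_indicM t r (integrable_dist (U t) iU)).
  exact: (measurable_restrictT _ (@measurable_period R)).1 h.
- apply: (measurable_restrictT _ (measurable_ball t r)).1.
  apply: measurable_funTS; apply/measurable_EFinP; apply: measurableT_comp => //.
  exact: measurable_funB.
- move=> s _; rewrite !patchE; case: ifPn => sp; case: ifPn => sb; rewrite ?lexx ?lee_fin//.
  + by rewrite indicE sb mul1r /= !patchE sp (mem_set pt).
  + by rewrite indicE (negbTE sb)/= mul0r.
Qed.

(** The definition of a Lebesgue point, with the average turned into a bound for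
    the mass near t. The extension of U by 0 makes it a function on the line. *)
Lemma lebesgue_pt_mass (U : R -> R) (t : R) : mu.-integrable period (fun s => (U s)%:E) ->
  period t -> lebesgue_pt (U \_ period) t -> forall e : R, 0 < e ->
  exists2 h : R, 0 < h & forall r, 0 < r < h ->
    \int[mu]_(s in period) (\1_(ball t r) s * `|U s - U t|) <= 2 * r * e.
Proof.
move=> iU pt + e e0; rewrite /lebesgue_pt => /fine_cvgP[fin /cvgrPdist_lt/(_ _ e0)].
move=> hd; have : \forall r \near (0 : R)^'+, davg (U \_ period) t r \is a fin_num /\
    `|0 - fine (davg (U \_ period) t r)| < e.
  by near=> r; split; near: r.
rewrite near_withinE => /nbhs_ballP[h /= h0 hP]; exists h => // r /andP[r0 rh].
have [] := hP r _ r0; first by rewrite /ball /= sub0r normrN gtr0_norm.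
set I := (\int[mu]_(s in ball t r) `|(center ((U \_ period) t) \o (U \_ period)) s|%:E)%E.
have dE : davg (U \_ period) t r = ((2 * r)^-1%:E * I)%E.
  rewrite /davg /iavg (lebesgue_measure_ball _ (ltW r0)) inver mulrn_eq0/= gt_eqF//.
  by rewrite mulr_natl.
move=> dfin; rewrite sub0r normrN ger0_norm ?fine_ge0 ?davg_ge0// -lte_fin fineK// dE.
rewrite lte_pdivrMl ?mulr_gt0// => /ltW; rewrite -lee_fin => Ie.
rewrite /Rintegral fineK; last first.
  apply: (integrable_fin_num (@measurable_period R)).
  exact: (integrable_indicM _ _ (integrable_dist (U t) iU)).
apply: le_trans Ie; exact: integral_ball_period_le.
Unshelve. all: by end_near. Qed.

(** The j-th term contributes at most (4 / d) 4^-j * 2 (d 2^j) e = 8 e / 2^j.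
    The induction needs the exact partial sum 16 e - 8 e / 2^N of this geometric
    series. *)
Lemma dyadic_kernel_integral (D : R -> R) (d t h e : R) N : 0 < d -> 0 < e ->
  mu.-integrable period (fun s => (D s)%:E) ->
  (forall r, 0 < r < h -> \int[mu]_(s in period) (\1_(ball t r) s * D s) <= 2 * r * e) ->
  d * 2 ^+ N < h ->
  mu.-integrable period (fun s => (dyadic_kernel d t N s * D s)%:E) /\
  \int[mu]_(s in period) (dyadic_kernel d t N s * D s) <= 16 * e.
Proof.
move=> d0 e0 iD hD dN.
suff : mu.-integrable period (fun s => (dyadic_kernel d t N s * D s)%:E) /\
  \int[mu]_(s in period) (dyadic_kernel d t N s * D s) <= 16 * e - 8 * e / 2 ^+ N.
  move=> [? /le_trans le]; split=> //; apply: le.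
  by rewrite lerBlDr lerDl divr_ge0 ?exprn_ge0// mulr_ge0// ltW.
have term j : (j <= N)%N ->
  mu.-integrable period (fun s => (4 / d / 4 ^+ j * (\1_(ball t (d * 2 ^+ j)) s * D s))%:E) /\
  \int[mu]_(s in period) (4 / d / 4 ^+ j * (\1_(ball t (d * 2 ^+ j)) s * D s)) <= 8 * e / 2 ^+ j.
  move=> jN; have i1 := @integrable_indicM D t (d * 2 ^+ j) iD.
  split; first exact: (integrableZl (@measurable_period R) (4 / d / 4 ^+ j) i1).
  rewrite RintegralZl//.
  have le := hD (d * 2 ^+ j) _.
  apply: (@le_trans _ _ (4 / d / 4 ^+ j * (2 * (d * 2 ^+ j) * e))).
    rewrite ler_wpM2l//; first by rewrite !divr_ge0 ?exprn_ge0// ltW.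
    apply: le; rewrite mulr_gt0 ?exprn_gt0//= (le_lt_trans _ dN)//.
    by rewrite ler_wpM2l ?(ltW d0)// ler_weXn2l// ler1n.
  have q0 : (2 : R) ^+ j != 0 by rewrite expf_neq0.
  have -> : 4 ^+ j = (2 ^+ j) ^+ 2 :> R.
    have four : 4 = 2 ^+ 2 :> R by rewrite -natrX.
    by rewrite four -!exprM mulnC.
  by apply: eq_le_refl; move: (2 ^+ j) q0 => q q0; field; rewrite q0 gt_eqF.
elim: N dN term => [|N IH] dN term.
  have [i1 le] := term 0%N isT.
  have E : (fun s => dyadic_kernel d t 0 s * D s) =
      fun s => 4 / d / 4 ^+ 0 * (\1_(ball t (d * 2 ^+ 0)) s * D s).
    by apply/funext => s; rewrite /dyadic_kernel big_ord_recl big_ord0 addr0 mulrA.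
  split; first by have := i1; rewrite -(congr1 (fun f => (fun s => (f s)%:E)) E).
  rewrite /Rintegral; have -> : (fun s => (dyadic_kernel d t 0 s * D s)%:E) =
      fun s => (4 / d / 4 ^+ 0 * (\1_(ball t (d * 2 ^+ 0)) s * D s))%:E.
    exact: (congr1 (fun f => (fun s => (f s)%:E)) E).
  by apply: (le_trans le); rewrite expr0; lra.
have dN' : d * 2 ^+ N < h.
  by rewrite (le_lt_trans _ dN)// ler_wpM2l ?(ltW d0)// ler_weXn2l// ler1n.
have [i1 le1] := IH dN' (fun j jN => term j (leqW jN)).
have [i2 le2] := term N.+1 (leqnn _).
have E : (fun s => (dyadic_kernel d t N.+1 s * D s)) =
   fun s => (dyadic_kernel d t N s * D s + 4 / d / 4 ^+ N.+1 * (\1_(ball t (d * 2 ^+ N.+1)) s * D s)).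
  by apply/funext => s; rewrite /dyadic_kernel big_ord_recr mulrDl /= !mulrA.
have EE := congr1 (fun f => (fun s => (f s)%:E)) E; rewrite /= in EE.
split; first by rewrite EE; exact: (integrableD (@measurable_period R) i1 i2).
rewrite /Rintegral EE -/(Rintegral _ _ _) RintegralD//.
have q0 : (2 : R) ^+ N != 0 by rewrite expf_neq0.
apply: le_trans (lerD le1 le2) _; rewrite [2 ^+ N.+1]exprS.
by apply: eq_le_refl; move: (2 ^+ N) q0 => q q0; field.
Qed.

(** The proof of Fatou's theorem needs an interval around t inside the period. *)
Lemma ae_interior : {ae mu, forall t : R, period t -> 0 < t < 2 * pi}.
Proof.
have neg (x : R) : mu.-negligible [set x].
  by exists [set x]; split => //; exact: lebesgue_measure_set1.
apply: negligibleS (negligibleU (neg 0) (neg (2 * pi))) => t /= /not_implyP[].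
rewrite /Defs.period /= in_itv /= => /andP[t0 t1] /negP.
rewrite negb_and -!leNgt => /orP[h|h]; [left|right]; apply/eqP; rewrite eq_le.
- by rewrite h t0.
- by rewrite t1 h.
Qed.

(** The numerator of the kernel is (1 - r) (1 + r) <= 2 (1 - r), and for
    r >= 1 / 2 the denominator is at least 1 - cos (s - t). *)
Lemma poisson_kernel_cos (r s t : R) : 2^-1 <= r < 1 ->
  poisson_kernel (r%:C * val (circ t)) (circ s) * (1 - cos (s - t)) <= 2 * (1 - r).
Proof.
move=> /andP[r2 r1]; have r0 : 0 <= r by rewrite (le_trans _ r2).
have cr : cabs (r%:C * val (circ t)) = r by rewrite cabsM cabs_circle mulr1 cabsR ger0_norm.
have z1 : cabs (r%:C * val (circ t)) < 1 by rewrite cr.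
have K0 := poisson_kernel_ge0 (circ s) z1; set K := poisson_kernel _ _ in K0 *.
have c0 : 0 <= 1 - cos (s - t) by rewrite subr_ge0 cos_le1.
have KQ : K * ((1 - r) ^+ 2 + 2 * r * (1 - cos (s - t))) = (1 - r) * (1 + r).
  rewrite -cabs_circ_sub_sqr /K poisson_kernelE// cr divfK; first by ring.
  by rewrite expf_neq0// cabs_eq0 circle_sub_neq0.
have : K * (1 - cos (s - t)) <= K * ((1 - r) ^+ 2 + 2 * r * (1 - cos (s - t))).
  rewrite ler_wpM2l// ler_wpDl ?sqr_ge0// ler_peMl//; move: r2; lra.
rewrite KQ => /le_trans; apply; rewrite mulrC ler_wpM2r ?subr_ge0 ?ltW//.
by move: r1; lra.
Qed.

Lemma dyadic_exponent (d h : R) : 0 < d < h -> exists N, d * 2 ^+ N < h <= d * 2 ^+ N.+1.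
Proof.
move=> /andP[d0 dh].
have [n hn] : exists n, h <= d * 2 ^+ n.
  exists (Num.bound (h / d)); rewrite mulrC -ler_pdivrMr//.
  apply: (le_trans (ltW (archi_boundP _))); first by rewrite divr_ge0// ltW// (lt_trans d0).
  by rewrite -natrX ler_nat ltnW// ltn_expl.
have [m hm hmin] := @ex_minnP (fun n => h <= d * 2 ^+ n) (ex_intro _ n hn).
case: m hm hmin => [|m] hm hmin; first by move: hm; rewrite expr0 mulr1 leNgt dh.
exists m; rewrite hm andbT ltNge; apply/negP => /hmin.
by rewrite ltnn.
Qed.

(** Within distance (1 - r) 2^N of t the dyadic kernel dominates; farther away
    1 - cos (s - t) is bounded below, also when s and t are close to opposite ends
    of the period, and the kernel is O(1 - r). *)
Lemma poisson_dominated (r s t h : R) N : 2^-1 <= r < 1 -> 0 < h < pi ->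
  (forall x : R, `|x| < h -> x ^+ 2 / 8 <= 1 - cos x) ->
  (1 - r) * 2 ^+ N < h <= (1 - r) * 2 ^+ N.+1 ->
  h / 2 <= t <= 2 * pi - h / 2 -> 0 <= s <= 2 * pi ->
  poisson_kernel (r%:C * val (circ t)) (circ s) <=
  16 * dyadic_kernel (1 - r) t N s + 2 * (1 - r) / (1 - cos (h / 2)).
Proof.
move=> r01 /andP[h0 hpi] hcos /andP[dN dN1] /andP[t0 t1] /andP[s0 s1].
have Kc := poisson_kernel_cos s t r01.
have /andP[r2 r1] := r01; have r0 : 0 <= r by rewrite (le_trans _ r2).
have cr : cabs (r%:C * val (circ t)) = r by rewrite cabsM cabs_circle mulr1 cabsR ger0_norm.
have z1 : cabs (r%:C * val (circ t)) < 1 by rewrite cr.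
have K0 := poisson_kernel_ge0 (circ s) z1.
have := poisson_kernel_le (circ s) z1; rewrite ger0_norm// cr => K2.
set K := poisson_kernel _ _ in K0 Kc K2 *.
have d0 : 0 < 1 - r by rewrite subr_gt0.
have c1 : 0 < 1 - cos (h / 2).
  by rewrite subr_gt0 cos_lt1// divr_gt0//= ltr_pdivrMr// (lt_trans hpi)// ltr_pMr ?pi_gt0// ltr1n.
have [st|st] := ltP `|s - t| ((1 - r) * 2 ^+ N).
  rewrite ler_wpDr//; first by rewrite divr_ge0 ?mulr_ge0// ltW.
  apply: dyadic_kernel_ge => //.
  have := hcos (s - t) (lt_trans st dN) => /(ler_wpM2l K0) hk.
  by have := le_trans hk Kc; lra.
have hst : h / 2 <= `|s - t|.
  rewrite ler_pdivrMr//; apply: le_trans dN1 _; rewrite exprSr mulrA ler_wpM2r//.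
have cst : cos (s - t) <= cos (h / 2).
  apply: cos_le_cos_far => //.
    by rewrite divr_gt0//= ltr_pdivrMr// (lt_trans hpi)// ltr_pMr ?pi_gt0// ltr1n.
  by rewrite ler_norml; apply/andP; split; lra.
rewrite ler_wpDl//.
  rewrite mulr_ge0// /dyadic_kernel sumr_ge0// => j _.
  by rewrite mulr_ge0// ?indicE// !divr_ge0 ?exprn_ge0// ltW.
rewrite ler_pdivlMr// (le_trans _ Kc)// ler_wpM2l//; lra.
Qed.

(** At a Lebesgue point t interior to the period, the difference between the
    Poisson integral and the value is at most the integral of the kernel against
    D = |U - U t|. Near t the dyadic kernel and the small mass of D bound it, and the
    rest is O(1 - r). *)
Theorem fatou_poisson (u : circle R -> R) : intT u ->
  ae_circle (fun w => poisson u (r%:C * val w) @[r --> 1^'-] --> u w).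
Proof.
move=> iu; pose U s := u (circ s).
have iU : mu.-integrable period (fun s => (U s)%:E) by exact: iu.
have lebU : {ae mu, forall t, lebesgue_pt (U \_ period) t}.
  by apply: lebesgue_differentiation; exact: (integrable_locally_restrict (@measurable_period R) iU).
have := ae_interior; rewrite /ae_circle; apply: filterS2 lebU => t leb + pt => /(_ pt) /andP[t0 t2].
pose D (s : R) : R := `|U s - U t|.
have iD : mu.-integrable period (fun s => (D s)%:E) by exact: integrable_dist.
pose A := \int[mu]_(s in period) D s.
have A0 : 0 <= A.
  rewrite /A /Rintegral; apply: fine_ge0; apply: integral_ge0 => s _; rewrite lee_fin; exact: normr_ge0.
apply/cvgrPdist_le => e e0.
(* the near part is bounded by 16 (domination) times 16 (dyadic sum) times the
   density of mass, to be at most e / 2 *)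
have e2 : 0 < e / 32 / 16 by rewrite !divr_gt0.
have [h1 h10 hmass] := lebesgue_pt_mass iU pt leb e2.
have [h2 h20 hcos] := onem_cos_ge_near0.
have [h [h0 [hh1 [hh2 [hpi [ht0 ht2]]]]]] : exists h : R,
    0 < h /\ h <= h1 /\ h <= h2 /\ h < pi /\ h / 2 <= t /\ t <= 2 * pi - h / 2.
  exists (Num.min (Num.min h1 h2) (Num.min 1 (Num.min t (2 * pi - t)))).
  set h := Num.min _ _.
  have a1 : h <= h1 by rewrite /h !ge_min lexx.
  have a2 : h <= h2 by rewrite /h !ge_min lexx ?orbT.
  have a3 : h <= 1 by rewrite /h !ge_min lexx ?orbT.
  have a4 : h <= t by rewrite /h !ge_min lexx ?orbT.
  have a5 : h <= 2 * pi - t by rewrite /h !ge_min lexx ?orbT.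
  have a6 : 0 < h by rewrite /h !lt_min h10 h20 ltr01 t0 subr_gt0 t2.
  have := @pi_ge2 R; clearbody h => p2.
  by do 5 (split; first by lra); lra.
pose c := 1 - cos (h / 2).
have c0 : 0 < c.
  by rewrite subr_gt0 cos_lt1// divr_gt0//= ltr_pdivrMr// (lt_trans hpi)// ltr_pMr ?pi_gt0// ltr1n.
have A1 : 0 < 2 * (1 + A) by rewrite mulr_gt0// ltr_pwDl.
(* the normalization of arc length is dropped *)
have p1 : (2 * pi)^-1 <= 1 :> R.
  by rewrite invf_le1 ?twopi_gt0//; have := @pi_ge2 R; lra.
have fin (x y : R) : x <= 16 * (e / 32 / 16) -> y <= e / 2 -> 16 * x + y <= e by lra.
have X0 : 0 < e / 2 * c / (2 * (1 + A)) by rewrite divr_gt0// mulr_gt0// divr_gt0.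
near=> r.
have r2 : 2^-1 <= r by near: r; apply: nbhs_left_ge; rewrite invf_lt1// ltr1n.
have r1 : r < 1 by near: r; exact: nbhs_left_lt.
have rh : 1 - r < h.
  by rewrite ltrBlDl -ltrBlDr; near: r; apply: nbhs_left_gt; rewrite ltrBlDr ltrDl.
have rA : 2 * (1 - r) / c * A <= e / 2.
  rewrite mulrAC ler_pdivrMr// mulrAC.
  have : (1 - r) <= e / 2 * c / (2 * (1 + A)).
    rewrite lerBlDl -lerBlDr; near: r; apply: nbhs_left_ge.
    by rewrite ltrBlDr ltrDl.
  rewrite ler_pdivlMr// => /(le_trans _); apply.
  have : 0 <= 1 - r by rewrite subr_ge0 ltW.
  nra.
have r01 : 2^-1 <= r < 1 by rewrite r2.
have [N hN] := @dyadic_exponent (1 - r) h (introT andP (conj (etrans (subr_gt0 _ _) r1) rh)).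
have /andP[dN _] := hN.
have cr : cabs (r%:C * val (circ t)) = r.
  by rewrite cabsM cabs_circle mulr1 cabsR ger0_norm// (le_trans _ r2).
have z1 : cabs (r%:C * val (circ t)) < 1 by rewrite cr.
have [iK leK] := @dyadic_kernel_integral D (1 - r) t h (e / 32 / 16) N
  (etrans (subr_gt0 _ _) r1) e2 iD (fun r0 h0 => hmass r0 (introT andP
    (conj (proj1 (andP h0)) (lt_le_trans (proj2 (andP h0)) hh1)))) dN.
set z := r%:C * val (circ t) in cr z1 *.
have iz := intT_poisson iu z1; have ik := intT_poisson_kernel z1.
pose f w := poisson_kernel z w * u w - u (circ t) * poisson_kernel z w.
have if_ : intT f by apply: intTB => //; exact: intTZ.
have -> : u (circ t) - poisson u z = - avg f.
  by rewrite /f avgB//; [rewrite avgZ// avg_poisson_kernel// mulr1 opprB|exact: intTZ].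
rewrite normrN; apply: (le_trans (le_norm_avg if_)); rewrite /avg.
have i1 : mu.-integrable period (fun s => (16 * (dyadic_kernel (1 - r) t N s * D s))%:E).
  exact: (integrableZl (@measurable_period R) 16 iK).
have i2 : mu.-integrable period (fun s => (2 * (1 - r) / c * D s)%:E).
  exact: (integrableZl (@measurable_period R) (2 * (1 - r) / c) iD).
have le : \int[mu]_(s in period) `|f (circ s)| <=
    \int[mu]_(s in period) (16 * (dyadic_kernel (1 - r) t N s * D s) + 2 * (1 - r) / c * D s).
  apply: le_Rintegral => //.
  - exact: intT_norm if_.
  - exact: (integrableD (@measurable_period R) i1 i2).
  - move=> s; rewrite /Defs.period /= in_itv /= => s02.
    have -> : f (circ s) = poisson_kernel z (circ s) * (U s - U t) by rewrite /f /U; ring.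
    rewrite normrM ger0_norm ?poisson_kernel_ge0// mulrA -mulrDl.
    apply: ler_wpM2r; first exact: normr_ge0.
    apply: (@poisson_dominated r s t h N r01) => //; first by rewrite h0.
      by move=> x xh; apply: hcos; rewrite (lt_le_trans xh).
    by rewrite ht0.
rewrite RintegralD// RintegralZl// RintegralZl// -/A in le.
apply: (@le_trans _ _ (\int[mu]_(s in period) `|f (circ s)|)).
  rewrite ler_piMl//; apply: fine_ge0; apply: integral_ge0 => s _; rewrite lee_fin; exact: normr_ge0.
exact: (le_trans le (fin _ _ leK rA)).
Unshelve. all: by end_near. Qed.

End Fatou.

(** * Algebra of the Hardy spaces *)

Section HardySpaces.
Context {R : realType}.
Local Notation C := R[i].
Local Notation T := (circle R).
Local Notation mu := (@lebesgue_measure R).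
Local Notation period := (@period R).
Implicit Types (f g h : T -> C) (F G : C -> C) (z : C).

Lemma holomorphic_discP F :
  holomorphic_disc F <-> forall z, cabs z < 1 -> exists d, cderiv F z d.
Proof.
split=> hF z /hF; first exact: derivable_cderiv.
by move=> [d]; exact: cderiv_derivable.
Qed.

Lemma holomorphic_discD F G : holomorphic_disc F -> holomorphic_disc G ->
  holomorphic_disc (fun z => F z + G z).
Proof. by move=> hF hG z z1; apply: derivableD; [exact: hF|exact: hG]. Qed.

Lemma holomorphic_discM F G : holomorphic_disc F -> holomorphic_disc G ->
  holomorphic_disc (fun z => F z * G z).
Proof. by move=> hF hG z z1; apply: (@derivableM C^o C^o F G); [exact: hF|exact: hG]. Qed.

Lemma holomorphic_disc_cst (c : C) : holomorphic_disc (fun=> c).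
Proof. by move=> z _; exact: derivable_cst. Qed.

Lemma holomorphic_disc_id : holomorphic_disc (fun z : C => z).
Proof. by move=> z _; exact: derivable_id. Qed.

Lemma holomorphic_disc_scale F (s : R) : 0 < s <= 1 -> holomorphic_disc F ->
  holomorphic_disc (fun z => F (s%:C * z)).
Proof.
move=> /andP[s0 s1] /holomorphic_discP hF; apply/holomorphic_discP => z z1.
have [|d hd] := hF (s%:C * z).
  by rewrite cabsM cabsR gtr0_norm// (le_lt_trans _ z1)// ler_piMl// cabs_ge0.
by exists (s%:C * d); exact: cderiv_scale.
Qed.

Lemma holomorphic_herglotz f : L1 f -> holomorphic_disc (herglotz f).
Proof. by move=> f1; apply/holomorphic_discP => z z1; exact: cderiv_herglotz. Qed.

Lemma holomorphic_cexp F : holomorphic_disc F -> holomorphic_disc (fun z => cexp (F z)).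
Proof.
move=> /holomorphic_discP hF; apply/holomorphic_discP => z /hF[d hd].
by exists (cexp (F z) * d); exact: cderiv_cexp.
Qed.

Lemma cabs_rcircle (r : R) (w : T) : 0 <= r -> cabs (r%:C * val w) = r.
Proof. by move=> r0; rewrite cabsM cabs_circle mulr1 cabsR ger0_norm. Qed.

(** Analytic functions are continuous, hence measurable on smaller circles. *)
Lemma measurableT_dilation F (r : R) : holomorphic_disc F -> 0 <= r < 1 ->
  measurableT (fun w => F (r%:C * val w)).
Proof.
move=> hF /andP[r0 r1].
have cF : forall t : R, ((F (r%:C * val (circ s)) : C^o) @[s --> t] --> (F (r%:C * val (circ t)) : C^o)).
  move=> t; have zr : cabs (r%:C * val (circ t)) < 1 by rewrite cabs_rcircle.
  have [d /cderiv_continuous cF] := derivable_cderiv (hF _ zr).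
  apply: (@cvg_comp _ _ _ (fun s : R => r%:C * val (circ s) : C^o) (F : C^o -> C^o)
    _ (nbhs (r%:C * val (circ t) : C^o))); last exact: cF.
  apply: cvgC_ReIm; rewrite /= !mul0r.
  - under eq_fun do rewrite mul0r subr0; rewrite subr0.
    by apply: cvgMr; exact: continuous_cos.
  - under eq_fun do rewrite mul0r addr0; rewrite addr0.
    by apply: cvgMr; exact: continuous_sin.
split; apply: measurable_funTS; apply: continuous_measurable_fun => t.
- exact: (cvgC_Re (cF t)).
- exact: (cvgC_Im (cF t)).
Qed.

(** Dominated convergence applies along a sequence of radii; the shift by 2
    makes them all positive. *)
Definition radii (n : nat) : R := 1 - n.+2%:R^-1.

Lemma radii_gt0 n : 0 < radii n.
Proof. by rewrite subr_gt0 invf_lt1// ltr1n. Qed.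

Lemma radii_lt1 n : radii n < 1.
Proof. by rewrite ltrBlDr ltrDl invr_gt0. Qed.

Lemma cvg_radii : radii n @[n --> \oo] --> (1 : R)^'-.
Proof.
have r1 : radii n @[n --> \oo] --> (1 : R).
  rewrite -[X in _ --> X]subr0; apply: cvgB; first exact: cvg_cst.
  by have := @cvg_harmonic R; rewrite -cvg_shiftS.
move=> A hA; have hA' : \forall x \near (1 : R), x < 1 -> A x by exact: hA.
have h : \forall n \near \oo, radii n < 1 -> A (radii n) by exact: r1 _ hA'.
have : \forall n \near \oo, A (radii n) by apply: filterS h => n; apply; exact: radii_lt1.
by [].

Qed.

Lemma boundary_seq F f : boundary_function F f ->
  ae_circle (fun w => ((F ((radii n)%:C * val w) : C^o) @[n --> \oo] --> (f w : C^o))).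
Proof.
move=> [_]; apply: ae_circleS => w Fw.
exact: (cvg_comp _ _ cvg_radii Fw).
Qed.

Lemma boundaryD F G f g : boundary_function F f -> boundary_function G g ->
  boundary_function (fun z => F z + G z) (fun w => f w + g w).
Proof.
move=> [mf Ff] [mg Gg]; split; first exact: measurableTD.
by apply: ae_circleS2 Ff Gg => w; exact: cvgD.
Qed.

Lemma boundaryM F G f g : boundary_function F f -> boundary_function G g ->
  boundary_function (fun z => F z * G z) (fun w => f w * g w).
Proof.
move=> [mf Ff] [mg Gg]; split; first exact: measurableTM.
by apply: ae_circleS2 Ff Gg => w; exact: cvgM.
Qed.

Lemma boundary_cst (c : C) : boundary_function (fun=> c) (fun=> c).
Proof. by split; [exact: measurableT_cst|apply: ae_circleW => w; exact: cvg_cst]. Qed.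

Lemma cvg_radial (w : T) :
  (r%:C * val w : C^o) @[r --> (1 : R)^'-] --> (val w : C^o).
Proof.
apply/cvgC/cvgrPdist_le => e e0; near=> r.
have r1 : r < 1 by near: r; exact: nbhs_left_lt.
have re : 1 - e < r by near: r; apply: nbhs_left_gt; rewrite ltrBlDr ltrDl.
rewrite sub0r normrN ger0_norm ?cabs_ge0//.
rewrite -[X in _ - X]mul1r -mulrBl cabsM cabs_circle mulr1.
rewrite -[1%R]/((1 : R)%:C) -(rmorphB (real_complex R)) cabsR distrC ger0_norm ?subr_ge0 ?ltW//.
by rewrite ltrBlDr -ltrBlDl.
Unshelve. all: by end_near. Qed.

Lemma boundary_id : boundary_function (fun z => z) (@zfun R).
Proof.
split; first exact: measurableT_zfun.
by apply: ae_circleW => w; exact: cvg_radial.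
Qed.

(** A bound on the extended integral makes it finite, and it is then the real
    mean up to the factor 2 pi. *)
Lemma integral_sqr_le f (M : R) : measurableT f ->
  ((\int[mu]_(t in period) (cabs (f (circ t)) ^+ 2)%:E <= M%:E)%E <->
   intT (fun w => cabs (f w) ^+ 2) /\ avg (fun w => cabs (f w) ^+ 2) <= M / (2 * pi)).
Proof.
move=> mf; split=> [hM|[i2 hM]].
  have i2 : intT (fun w => cabs (f w) ^+ 2).
    by apply: (proj2 ((L2P _).1 _)); split=> //; exact: (le_lt_trans hM (ltry _)).
  split=> //; rewrite /avg mulrC ler_wpM2r ?invr_ge0 ?(ltW twopi_gt0)//.
  by rewrite -lee_fin /Rintegral fineK//; exact: (integrable_fin_num (@measurable_period R) i2).
rewrite -(fineK (integrable_fin_num (@measurable_period R) i2)) lee_fin.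
by move: hM; rewrite /avg mulrC ler_pM2r// invr_gt0 twopi_gt0.
Qed.

Lemma H2_discP F : H2_disc F <-> holomorphic_disc F /\ exists M : R, forall r : R, 0 <= r < 1 ->
  intT (fun w => cabs (F (r%:C * val w)) ^+ 2) /\ avg (fun w => cabs (F (r%:C * val w)) ^+ 2) <= M.
Proof.
split=> -[hF [M hM]]; split=> //.
- exists (M / (2 * pi)) => r r01; apply/integral_sqr_le; last exact: hM.
  exact: measurableT_dilation.
- exists (M * (2 * pi)) => r r01.
  apply: ((integral_sqr_le (f := fun w => F (r%:C * val w)) _ _).2).
    exact: measurableT_dilation.
  by rewrite mulfK ?gt_eqF ?twopi_gt0//; exact: hM.
Qed.

Lemma H2_discD F G : H2_disc F -> H2_disc G -> H2_disc (fun z => F z + G z).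
Proof.
move=> /H2_discP[hF [M hM]] /H2_discP[hG [N hN]]; apply/H2_discP; split.
  exact: holomorphic_discD.
exists (2 * M + 2 * N) => r r01; have [iF lF] := hM r r01; have [iG lG] := hN r r01.
have ib : intT (fun w => 2 * cabs (F (r%:C * val w)) ^+ 2 + 2 * cabs (G (r%:C * val w)) ^+ 2).
  by apply: intTD; exact: intTZ.
have is_ : intT (fun w => cabs (F (r%:C * val w) + G (r%:C * val w)) ^+ 2).
  apply: (le_intT _ ib).
    by apply: measR_cabs_sqr; apply: measurableTD; exact: measurableT_dilation.
  by apply: ae_circleW => w; rewrite ger0_norm ?sqr_ge0// sqr_cabsD_le.
split=> //; apply: (le_trans (le_avg is_ ib (fun w => sqr_cabsD_le _ _))).
by rewrite avgD ?avgZ//; [rewrite lerD// ler_wpM2l|exact: intTZ..].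
Qed.

Lemma Hinfty_discM F G : Hinfty_disc F -> Hinfty_disc G -> Hinfty_disc (fun z => F z * G z).
Proof.
move=> [hF [M hM]] [hG [N hN]]; split; first exact: holomorphic_discM.
by exists (M * N) => z z1; rewrite cabsM ler_pM ?cabs_ge0 ?hM ?hN.
Qed.

Lemma H2_disc_bddM F G : Hinfty_disc F -> H2_disc G -> H2_disc (fun z => F z * G z).
Proof.
move=> [hF [M hM]] /H2_discP[hG [N hN]]; apply/H2_discP; split; first exact: holomorphic_discM.
exists (M ^+ 2 * N) => r r01; have [iG lG] := hN r r01; have /andP[r0 r1] := r01.
have le (w : T) : cabs (F (r%:C * val w) * G (r%:C * val w)) ^+ 2 <= M ^+ 2 * cabs (G (r%:C * val w)) ^+ 2.
  rewrite cabsM exprMn ler_wpM2r ?sqr_ge0// lerXn2r ?nnegrE ?cabs_ge0//.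
    by rewrite (le_trans (cabs_ge0 (F 0)))// hM// cabs0.
  by apply: hM; rewrite cabs_rcircle.
have ib := intTZ (M ^+ 2) iG.
have is_ : intT (fun w => cabs (F (r%:C * val w) * G (r%:C * val w)) ^+ 2).
  apply: (le_intT _ ib).
    by apply: measR_cabs_sqr; apply: measurableTM; exact: measurableT_dilation.
  by apply: ae_circleW => w; rewrite ger0_norm ?sqr_ge0.
split=> //; apply: (le_trans (le_avg is_ ib le)).
by rewrite avgZ// ler_wpM2l// sqr_ge0.
Qed.

Lemma Hinfty_cst (c : C) : Hinfty (fun=> c : C).
Proof.
split; first by split; [exact: measurableT_cst|exists (cabs c); exact: ae_circleW].
exists (fun=> c); last exact: boundary_cst.
by split; [exact: holomorphic_disc_cst|exists (cabs c)].
Qed.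

Lemma Hinfty_zfun : Hinfty (@zfun R).
Proof.
split.
  split; first exact: measurableT_zfun.
  by exists 1; apply: ae_circleW => w; rewrite /zfun cabs_circle.
exists (fun z => z); last exact: boundary_id.
by split; [exact: holomorphic_disc_id|exists 1 => z /ltW].
Qed.

Lemma LinftyM f g : Linfty f -> Linfty g -> Linfty (fun w => f w * g w).
Proof.
move=> [mf [M hM]] [mg [N hN]]; split; first exact: measurableTM.
by exists (M * N); apply: ae_circleS2 hM hN => w fM gN; rewrite cabsM ler_pM ?cabs_ge0.
Qed.

Lemma HinftyM f g : Hinfty f -> Hinfty g -> Hinfty (fun w => f w * g w).
Proof.
move=> [f8 [F hF Ff]] [g8 [G hG Gg]]; split; first exact: LinftyM.
by exists (fun z => F z * G z); [exact: Hinfty_discM|exact: boundaryM].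
Qed.

Lemma HinftyX f n : Hinfty f -> Hinfty (fun w => f w ^+ n).
Proof.
move=> hf; elim: n => [|n IH]; first exact: Hinfty_cst.
by under eq_fun do rewrite exprS; exact: HinftyM.
Qed.

Lemma H2M f g : Hinfty f -> H2 g -> H2 (fun w => f w * g w).
Proof.
move=> [[mf [M fM]] [F hF Ff]] [g2 [G hG Gg]]; split; first exact: (L2_bddM g2 mf fM).
by exists (fun z => F z * G z); [exact: H2_disc_bddM|exact: boundaryM].
Qed.

Lemma H2D f g : H2 f -> H2 g -> H2 (fun w => f w + g w).
Proof.
move=> [f2 [F hF Ff]] [g2 [G hG Gg]]; split; first exact: L2D.
by exists (fun z => F z + G z); [exact: H2_discD|exact: boundaryD].
Qed.

Lemma H2_disc1 : H2_disc (fun=> 1 : C).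
Proof.
apply/H2_discP; split; first exact: holomorphic_disc_cst.
by exists 1 => r _; rewrite cabs1 expr1n avg_cst; split; [exact: intT_cst|].
Qed.

Lemma H2_1 : H2 (fun=> 1 : C).
Proof.
split; first exact: L2_cst.
by exists (fun=> 1); [exact: H2_disc1|exact: boundary_cst].
Qed.

Lemma Hinfty_H2 f : Hinfty f -> H2 f.
Proof. by move=> /H2M/(_ H2_1); under eq_fun do rewrite mulr1. Qed.

Lemma H2Z (c : C) f : H2 f -> H2 (fun w => c * f w).
Proof. exact: H2M (Hinfty_cst c). Qed.

Lemma H2N f : H2 f -> H2 (fun w => - f w).
Proof. by move=> /(H2Z (-1)); under eq_fun do rewrite mulN1r. Qed.

Lemma H2B f g : H2 f -> H2 g -> H2 (fun w => f w - g w).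
Proof. by move=> f2 /H2N; exact: H2D. Qed.

Lemma H2_L2 f : H2 f -> L2 f. Proof. by case. Qed.

End HardySpaces.

(** * Bounded functions without negative frequencies *)

Section BoundedAnalytic.
Context {R : realType}.
Local Notation C := R[i].
Local Notation T := (circle R).
Implicit Types (f g h : T -> C) (F G : C -> C) (z c : C) (k u : T -> R).

(** The Poisson kernel is the half-sum of the Herglotz kernel and its conjugate,
    and the conjugate kernel integrates g to a constant when the coefficients of
    negative index of g vanish. *)
Lemma herglotz_analytic_poisson g z : L1 g ->
  (forall j, (0 < j)%N -> integralT (fun w => val w ^+ j * g w) = 0) -> cabs z < 1 ->
  2^-1 * (herglotz g z + integralT g) =
  poisson (fun w => complex.Re (g w)) z +i* poisson (fun w => complex.Im (g w)) z.
Proof.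
move=> g1 gj z1; have gJ := L1J g1.
have hJ : herglotz (fun w => (g w)^*) z = (integralT g)^*.
  rewrite herglotz_const// ?integralTJ// => j j0; rewrite /moment.
  have -> : (fun w : T => (val w)^-1 ^+ j * (g w)^*) = fun w => (val w ^+ j * g w)^*.
    by apply/funext => w; rewrite conjcM conjcX -(invc_unit (cabs_circle w)).
  rewrite integralTJ ?gj ?conjC0//; apply: (L1M_bdd (M := 1) g1).
    by apply: measurableTX; exact: measurableT_val.
  by apply: ae_circleW => w; rewrite cabsX cabs_circle expr1n.
have gE : integralT g = (herglotz (fun w => (g w)^*) z)^* by rewrite hJ conjCK.
have [gr gi] := g1.
have ir := intT_poisson gr z1; have ii := intT_poisson gi z1.
have -> : poisson (fun w => complex.Re (g w)) z +i* poisson (fun w => complex.Im (g w)) z =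
    integralT (fun w => (poisson_kernel z w)%:C * g w).
  rewrite integralTE; congr (_ +i* _); congr avg; apply/funext => w.
  - by rewrite cReM /= mul0r subr0.
  - by rewrite cImM /= mul0r addr0.
rewrite gE -integralTJ; last exact: L1_hkerM.
rewrite /herglotz -integralTD; [|exact: L1_hkerM|by apply: L1J; exact: L1_hkerM].
rewrite -integralTZ; last by apply: L1D; [exact: L1_hkerM|apply: L1J; exact: L1_hkerM].
congr integralT; apply/funext => w; rewrite conjcM conjCK -mulrDl mulrA; congr (_ * _).
rewrite /poisson_kernel; set q := _ / _; clearbody q.
by apply: eq_ReIm; rewrite ?(cReM, cImM, cReD, cImD, cReJ, cImJ, cReV, cImV, cabs_nat) /=; field; exact: isT.
Qed.

(** The Poisson integral is bounded by positivity of the kernel, analytic by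
    [herglotz_analytic_poisson], and has the right limits by Fatou's theorem. *)
Lemma Hinfty_of_moments g : Linfty g ->
  (forall j, (0 < j)%N -> integralT (fun w => val w ^+ j * g w) = 0) -> Hinfty g.
Proof.
move=> g8 gj; split=> //; have [mg [M gM]] := g8.
have g1 : L1 g by exact: L1_bdd gM.
have [gr gi] := g1.
have hp z (z1 : cabs z < 1) := herglotz_analytic_poisson g1 gj z1.
exists (fun z => 2^-1 * (herglotz g z + integralT g)); last split=> //.
- split.
    apply: holomorphic_discM; first exact: holomorphic_disc_cst.
    apply: holomorphic_discD; last exact: holomorphic_disc_cst.
    exact: holomorphic_herglotz.
  have bdd u z : cabs z < 1 -> intT u -> ae_circle (fun w => `|u w| <= M) -> `|poisson u z| <= M.
    move=> z1 iu uM; rewrite ler_norml; apply/andP; split.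
      rewrite lerNl; have -> : - poisson u z = poisson (fun w => - u w) z.
        rewrite /poisson -avgN; last exact: intT_poisson.
        by congr avg; apply/funext => w; rewrite mulrN.
      apply: poisson_le => //; first exact: intTN.
      by apply: ae_circleS uM => w; rewrite ler_norml => /andP[? _]; rewrite lerNl.
    apply: poisson_le => //.
    by apply: ae_circleS uM => w; exact: le_trans (ler_norm _).
  exists (M + M) => z z1; rewrite hp// (le_trans (cabs_le_ReIm _))//= lerD// bdd//.
  + by apply: ae_circleS gM => w; apply: le_trans; exact: Re_le_cabs.
  + by apply: ae_circleS gM => w; apply: le_trans; exact: Im_le_cabs.
- apply: ae_circleS2 (fatou_poisson gr) (fatou_poisson gi) => w wr wi.
  have E : \forall r \near (1 : R)^'-,
      2^-1 * (herglotz g (r%:C * val w) + integralT g) =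
      poisson (fun w => complex.Re (g w)) (r%:C * val w) +i*
      poisson (fun w => complex.Im (g w)) (r%:C * val w).
    near=> r; have r1 : r < 1 by near: r; exact: nbhs_left_lt.
    have r0 : 0 <= r by near: r; apply: nbhs_left_ge.
    by apply: hp; rewrite cabs_rcircle.
  apply: cvgC_ReIm.
  + by apply: cvg_trans wr; apply: near_eq_cvg; apply: filterS E => r ->.
  + by apply: cvg_trans wi; apply: near_eq_cvg; apply: filterS E => r ->.
Unshelve. all: by end_near. Qed.

Lemma boundary_dilation F (s : R) : holomorphic_disc F -> 0 < s < 1 ->
  boundary_function (fun z => F (s%:C * z)) (fun w : T => F (s%:C * val w)).
Proof.
move=> hF /andP[s0 s1]; split; first by apply: measurableT_dilation => //; rewrite ltW.
apply: ae_circleW => w.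
have zs : cabs (s%:C * val w) < 1 by rewrite cabs_rcircle// ltW.
have [d /cderiv_continuous cF] := derivable_cderiv (hF _ zs).
apply: (@cvg_comp _ _ _ (fun r : R => s%:C * (r%:C * val w) : C^o) (F : C^o -> C^o)
    _ (nbhs (s%:C * val w : C^o))); last exact: cF.
by apply: cvgM; [exact: cvg_cst|exact: cvg_radial].
Qed.

Lemma Hinfty_dilation F (s : R) : Hinfty_disc F -> 0 < s < 1 ->
  Hinfty (fun w => F (s%:C * val w)).
Proof.
move=> [hF [M hM]] s01; have bF := boundary_dilation hF s01; have /andP[s0 s1] := s01.
split.
  split; first exact: bF.1.
  by exists M; apply: ae_circleW => w; apply: hM; rewrite cabs_rcircle// ltW.
exists (fun z => F (s%:C * z)); last exact: bF.
split; first by apply: holomorphic_disc_scale => //; rewrite s0 ltW.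
exists M => z z1; apply: hM; rewrite cabsM cabsR gtr0_norm//.
by rewrite (le_lt_trans _ z1)// ler_piMl ?cabs_ge0// ltW.
Qed.

End BoundedAnalytic.

(** * Outer functions *)

Section Outer.
Context {R : realType}.
Local Notation C := R[i].
Local Notation T := (circle R).
Implicit Types (f g h psi : T -> C) (F G : C -> C) (z c : C) (k u : T -> R).

Lemma outer_discE c k z : outer_disc c k z = c * cexp (herglotz (fun w => (k w)%:C) z).
Proof. by []. Qed.

Lemma cabs_outer_disc c k z : cabs c = 1 -> cabs (outer_disc c k z) = expR (poisson k z).
Proof. by move=> c1; rewrite outer_discE cabsM c1 mul1r cabs_cexp Re_herglotz. Qed.

Lemma holomorphic_outer_disc c k : intT k -> holomorphic_disc (outer_disc c k).
Proof.
move=> ik; apply: holomorphic_discM; first exact: holomorphic_disc_cst.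
by apply: holomorphic_cexp; apply: holomorphic_herglotz; exact: L1_real.
Qed.

Lemma cabs_outer_disc_le c k z (B : R) : cabs c = 1 -> intT k ->
  ae_circle (fun w => k w <= B) -> cabs z < 1 -> cabs (outer_disc c k z) <= expR B.
Proof. by move=> c1 ik kB z1; rewrite cabs_outer_disc// ler_expR poisson_le. Qed.

Lemma Hinfty_outer_disc c k (B : R) : cabs c = 1 -> intT k ->
  ae_circle (fun w => k w <= B) -> Hinfty_disc (outer_disc c k).
Proof.
move=> c1 ik kB; split; first exact: holomorphic_outer_disc.
by exists (expR B) => z; exact: cabs_outer_disc_le.
Qed.

(** The modulus of an outer function is the exponential of the Poisson integral
    of k, so Fatou's theorem applies. *)
Lemma cabs_outer_boundary c k f : cabs c = 1 -> intT k ->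
  boundary_function (outer_disc c k) f -> ae_circle (fun w => cabs (f w) = expR (k w)).
Proof.
move=> c1 ik [mf]; apply: ae_circleS2 (fatou_poisson ik) => w Pk /cvgC_cabs Ff.
have Ef : cabs (outer_disc c k (r%:C * val w)) @[r --> (1 : R)^'-] --> expR (k w).
  under eq_fun do rewrite cabs_outer_disc//.
  by apply: continuous_cvg => //; exact: continuous_expR.
exact: (cvg_unique _ Ff Ef).
Qed.

(** The product of the two outer functions, the second one dilated by s, is a
    constant times the exponential of a Herglotz integral; the mean value property
    holds on smaller circles, and passes to the unit circle by dominated
    convergence. *)
Lemma outer_mean c1 c2 k1 k2 f (s : R) (B1 B2 : R) : cabs c1 = 1 -> cabs c2 = 1 ->
  intT k1 -> intT k2 -> 0 < s < 1 ->
  ae_circle (fun w => k1 w <= B1) -> ae_circle (fun w => k2 w <= B2) ->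
  boundary_function (outer_disc c1 k1) f ->
  integralT (fun w => f w * outer_disc c2 k2 (s%:C * val w)) =
  c1 * c2 * (expR (avg k1 + avg k2))%:C.
Proof.
move=> h1 h2 i1 i2 s01 b1 b2 bf; have /andP[s0 s1] := s01.
have s01' : 0 < s <= 1 by rewrite s0 ltW.
have hq : Hinfty (fun w : T => outer_disc c2 k2 (s%:C * val w)).
  by apply: Hinfty_dilation s01; exact: Hinfty_outer_disc b2.
have mq := hq.1.1.
pose Phi z := outer_disc c1 k1 z * outer_disc c2 k2 (s%:C * z).
have hPhi : holomorphic_disc Phi.
  apply: holomorphic_discM; first exact: holomorphic_outer_disc.
  by apply: holomorphic_disc_scale => //; exact: holomorphic_outer_disc.
have Phi_le z : cabs z < 1 -> cabs (Phi z) <= expR B1 * expR B2.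
  move=> z1; rewrite cabsM ler_pM ?cabs_ge0 ?cabs_outer_disc_le//.
  by rewrite cabsM cabsR gtr0_norm// (le_lt_trans _ z1)// ler_piMl ?cabs_ge0// ltW.
have Phi_cexp z : Phi z = c1 * c2 * cexp (herglotz (fun w => (k1 w)%:C) z +
    herglotz (fun w => (k2 w)%:C) (s%:C * z)).
  by rewrite /Phi !outer_discE cexpD; ring.
have Phi0 : Phi 0 = c1 * c2 * (expR (avg k1 + avg k2))%:C.
  rewrite Phi_cexp mulr0 !herglotz0 !integralT_real; congr (_ * _).
  by rewrite /cexp -(rmorphD (real_complex R)) /= cos0 sin0 mulr1.
have mean n : integralT (fun w => Phi ((@radii R n)%:C * val w)) = Phi 0.
  have r0 := @radii_gt0 R n; have r1 := @radii_lt1 R n.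
  have r01 : 0 <= @radii R n < 1 by apply/andP; split; [exact: ltW|].
  have LP : L1 (fun w => Phi ((@radii R n)%:C * val w)).
    apply: (L1_bdd (M := expR B1 * expR B2)).
      exact: measurableT_dilation.
    by apply: ae_circleW => w; apply: Phi_le; rewrite cabs_rcircle// ltW.
  have PA : poly_approx (radii n) (fun z => herglotz (fun w => (k1 w)%:C) z +
      herglotz (fun w => (k2 w)%:C) (s%:C * z)).
    apply: poly_approxD; first by apply: poly_approx_herglotz => //; exact: L1_real.
    apply: poly_approx_scale; first by rewrite !ltW.
    by apply: poly_approx_herglotz => //; exact: L1_real.
  have E : Phi = fun z => (c1 * c2) * cexp (herglotz (fun w => (k1 w)%:C) z +
    herglotz (fun w => (k2 w)%:C) (s%:C * z)) by apply/funext.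
  apply: (poly_approx_mean (ltW r0) _ LP); rewrite E; apply: poly_approxZ.
  apply: (poly_approx_cexp (B := 2 / (1 - @radii R n) * avg (fun w => cabs (k1 w)%:C) +
    2 / (1 - @radii R n) * avg (fun w => cabs (k2 w)%:C))) => // z zr.
  apply: (le_trans (le_cabsD _ _)); apply: lerD.
    by apply: (cabs_herglotz_le (f := fun w => (k1 w)%:C)) => //; exact: L1_real.
  apply: (cabs_herglotz_le (f := fun w => (k2 w)%:C)) => //; first exact: L1_real.
  by rewrite cabsM cabsR gtr0_norm// (le_trans _ zr)// ler_piMl ?cabs_ge0// ltW.
have lim : (integralT (fun w => Phi ((@radii R n)%:C * val w)) : C^o) @[n --> \oo] -->
    (integralT (fun w => f w * outer_disc c2 k2 (s%:C * val w)) : C^o).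
  apply: (integralT_dominated (u := fun=> expR B1 * expR B2)).
  - move=> n; apply: measurableT_dilation => //.
    by apply/andP; split; [apply: ltW; exact: radii_gt0|exact: radii_lt1].
  - by apply: measurableTM => //; exact: bf.1.
  - exact: intT_cst.
  - have h := boundaryM bf (boundary_dilation (@holomorphic_outer_disc c2 k2 i2) s01).
    exact: (boundary_seq h).
  - move=> n; apply: ae_circleW => w; apply: Phi_le; rewrite cabs_rcircle ?radii_lt1//.
    by rewrite ltW// radii_gt0.
rewrite -Phi0; apply/eqP; rewrite -subr_eq0 -cabs_eq0; apply/eqP.
move: lim => /cvgC; under eq_fun do rewrite mean; move=> lim.
rewrite cabs_distC; apply: (cvg_unique _ _ lim) => //; exact: cvg_cst.
Qed.

End Outer.

(** * Cyclicity of bounded outer functions *)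

Section Cyclicity.
Context {R : realType}.
Local Notation C := R[i].
Local Notation T := (circle R).
Implicit Types (f g h psi : T -> C) (F G : C -> C) (z c : C) (k u : T -> R).

Definition excess u (n : nat) (w : T) : R := Num.max 0 (u w - n%:R).

Lemma excess_ge0 u n w : 0 <= excess u n w.
Proof. by rewrite le_max lexx. Qed.

Lemma excess_ge u n w : u w - n%:R <= excess u n w.
Proof. by rewrite le_max lexx orbT. Qed.

Lemma excess_le_norm u n w : excess u n w <= `|u w|.
Proof. by rewrite ge_max normr_ge0/= lerBlDr (le_trans (ler_norm _))// lerDl. Qed.

Lemma intT_excess u n : intT u -> intT (excess u n).
Proof.
move=> iu; apply: (le_intT _ (intT_norm iu)).
  by apply: measR_max; [exact: measR_cst|apply: measRB; [exact: intT_meas|exact: measR_cst]].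
by apply: ae_circleW => w; rewrite ger0_norm ?excess_ge0// excess_le_norm.
Qed.

(** Dominated convergence: each excess is eventually 0. *)
Lemma cvg_avg_excess u : intT u ->
  avg (excess u n) @[n --> \oo] --> 0.
Proof.
move=> iu; rewrite -[X in _ --> X](avg_cst 0).
apply: (avg_dominated (g := fun w => `|u w|) _ _ _ _ _).2.
- by move=> n; apply: intT_meas; exact: intT_excess.
- exact: measR_cst.
- exact: intT_norm.
- apply: ae_circleW => w; apply: cvg_near_cst; near=> n.
  apply/max_idPl; rewrite subr_le0; near: n.
  exact: nbhs_infty_ger.
- move=> n; apply: ae_circleW => w; rewrite ger0_norm ?excess_ge0//.
  exact: excess_le_norm.
Unshelve. all: by end_near. Qed.

Lemma cvg_ge_cst (x : R) (a : nat -> R) l : (forall n, x <= a n) ->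
  a n @[n --> \oo] --> l -> x <= l.
Proof.
move=> xa al; have <- := cvg_lim (@Rhausdorff R) al.
by apply: limr_ge; [apply/cvg_ex; exists l|exact: nearW].
Qed.

Lemma cabs_sqrB1 (a : C) : cabs (a - 1) ^+ 2 = cabs a ^+ 2 - 2 * complex.Re a + 1.
Proof. by rewrite !cabs_sqr; case: a => x y /=; rewrite subr0; ring. Qed.

(** Here v = Go q, where q is the dilation of the outer function of log-modulus
    k2 = - max (k, - n), and E = max (0, - k - n), so that k + k2 = - E. As psi v has
    mean 0, the mean of psi is that of psi (1 - v). Cutting psi at height K and using
    x <= d + x^2 / d for x = |v - 1| leaves the mean of |v - 1|^2, whose limit as the
    dilation factor tends to 1 is at most 2 (1 - exp (- avg E)) <= 2 avg E. *)
Lemma outer_cyclic_estimate c k Go psi (B : R) (n K : nat) (d : R) :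
  cabs c = 1 -> intT k -> boundary_function (outer_disc c k) Go ->
  ae_circle (fun w => k w <= B) -> L1 psi -> 0 < d ->
  (forall q, Hinfty q -> integralT (fun w => psi w * (Go w * q w)) = 0) ->
  cabs (integralT psi) <= 2 * avg (excess (fun w => cabs (psi w)) K) +
    (K%:R * d + K%:R / d * (2 * avg (excess (fun w => - k w) n))).
Proof.
move=> c1 ik bG kB psi1 d0 hpsi.
pose E := excess (fun w => - k w) n; pose k2 w := - (k w + E w).
have iE : intT E by apply: intT_excess; exact: intTN.
have ik2 : intT k2 by apply: intTN; exact: intTD.
have k2n : ae_circle (fun w => k2 w <= n%:R).
  by apply: ae_circleW => w; have := excess_ge (fun w => - k w) n w; rewrite -/(E w) /k2; lra.
have cJ1 : cabs c^* = 1 by rewrite cabsJ.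
have rm01 m : 0 < @radii R m < 1 by rewrite radii_gt0 radii_lt1.
pose q (m : nat) (w : T) := outer_disc c^* k2 ((@radii R m)%:C * val w).
have hq m : Hinfty (q m) by apply: (Hinfty_dilation _ (rm01 m)); exact: Hinfty_outer_disc k2n.
pose v m w := Go w * q m w.
have mGo : measurableT Go := bG.1.
have Gomod := cabs_outer_boundary c1 ik bG.
have GoB : ae_circle (fun w => cabs (Go w) <= expR B).
  by apply: ae_circleS2 Gomod kB => w ->; rewrite ler_expR.
have mv m : measurableT (v m) by apply: measurableTM => //; exact: (hq m).1.1.
pose M := expR B * expR n%:R.
have vM m : ae_circle (fun w => cabs (v m w) <= M).
  apply: ae_circleS GoB => w h; rewrite cabsM ler_pM ?cabs_ge0//.
  apply: cabs_outer_disc_le => //; rewrite cabs_rcircle; last exact: ltW (radii_gt0 _).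
  exact: radii_lt1.
have M0 : 0 <= M by rewrite mulr_ge0 ?expR_ge0.
have v1 m : L1 (v m) by exact: L1_bdd (vM m).
have iv m : integralT (v m) = (expR (- avg E))%:C.
  rewrite (outer_mean c1 cJ1 ik ik2 (rm01 m) kB k2n bG) mulcJ c1 expr1n mul1r.
  by rewrite avgN ?avgD//; [congr (_%:C); congr expR; ring|exact: intTD].
have vlim : ae_circle (fun w => cabs (v m w) @[m --> \oo] --> expR (- E w)).
  apply: ae_circleS2 Gomod (fatou_poisson ik2) => w Gw Pw.
  have Pn := cvg_comp _ _ (@cvg_radii R) Pw.
  have -> : - E w = k w + k2 w by rewrite /k2; ring.
  rewrite expRD -Gw; under eq_fun do rewrite cabsM cabs_outer_disc//.
  apply: cvgMr; apply: continuous_cvg; [exact: continuous_expR|exact: Pn].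
have E0 w : expR (- E w) <= 1 by rewrite -expR0 ler_expR oppr_le0 excess_ge0.
have mE : measR (fun w => expR (- E w)) by apply: measR_exp; apply: measRN; exact: intT_meas.
pose P := excess (fun w => cabs (psi w)) K.
have iP : intT P by apply: intT_excess; exact: L1_cabs.
have mP : measR P by exact: intT_meas.
have P0 w : 0 <= P w by exact: excess_ge0.
have iv2 m : intT (fun w => cabs (v m w) ^+ 2).
  apply: (intT_bdd (M := M ^+ 2)); first exact: measR_cabs_sqr.
  by apply: ae_circleS (vM m) => w h; rewrite ger0_norm ?sqr_ge0// lerXn2r// nnegrE cabs_ge0.
have iPv m : intT (fun w => P w * (cabs (v m w) + 1)).
  apply: (le_intT _ (intTZ (M + 1) iP)).
    by apply: measRM => //; apply: measRD; [exact: measR_cabs|exact: measR_cst].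
  apply: ae_circleS (vM m) => w h; rewrite normrM (ger0_norm (P0 w)) ger0_norm ?addr_ge0 ?cabs_ge0//.
  by rewrite mulrC ler_wpM2r// lerD2r.
have i12 m : intT (fun w => cabs (v m w - 1) ^+ 2).
  rewrite (_ : (fun w => _) = fun w => (cabs (v m w) ^+ 2 - 2 * complex.Re (v m w)) + 1); last first.
    by apply/funext => w; rewrite cabs_sqrB1.
  by apply: intTD; [apply: intTB => //; apply: intTZ; exact: (v1 m).1|exact: intT_cst].
have bound m : cabs (integralT psi) <= avg (fun w => P w * (cabs (v m w) + 1)) +
    (K%:R * d + K%:R / d * (avg (fun w => cabs (v m w) ^+ 2) - 2 * expR (- avg E) + 1)).
  have psiv : L1 (fun w => v m w * psi w) by exact: L1M_bdd psi1 (mv m) (vM m).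
  have -> : integralT psi = integralT (fun w => psi w - v m w * psi w).
    rewrite integralTB// (_ : integralT (fun w => v m w * psi w) = 0) ?subr0//.
    by rewrite -(hpsi (q m) (hq m)); congr integralT; apply/funext => w; rewrite mulrC.
  have L := L1B psi1 psiv.
  apply: le_trans (cabs_integralT_le L) _.
  have -> : avg (fun w => cabs (v m w) ^+ 2) - 2 * expR (- avg E) + 1 = avg (fun w => cabs (v m w - 1) ^+ 2).
    rewrite (_ : (fun w => cabs (v m w - 1) ^+ 2) =
      fun w => (cabs (v m w) ^+ 2 - 2 * complex.Re (v m w)) + 1); last first.
      by apply/funext => w; rewrite cabs_sqrB1.
    have ir := (v1 m).1; have := congr1 (@complex.Re R) (iv m); rewrite Re_integralT /= => <-.
    rewrite avgD ?avg_cst; [|by apply: intTB => //; exact: intTZ|exact: intT_cst].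
    by rewrite avgB ?avgZ//; exact: intTZ.
  have iS := intTZ (K%:R / d) (i12 m).
  have iT := intTD (intT_cst (K%:R * d)) iS.
  rewrite -(avgZ (K%:R / d) (i12 m)) -[X in _ + (X + _)]avg_cst -(avgD (intT_cst _) iS).
  rewrite -(avgD (iPv m) iT); apply: le_avg; [exact: L1_cabs|exact: intTD|] => w.
  have -> : psi w - v m w * psi w = psi w * (1 - v m w) by ring.
  rewrite cabsM cabs_distC; set x := cabs (v m w - 1).
  have x0 : 0 <= x by exact: cabs_ge0.
  have xv : x <= cabs (v m w) + 1 by rewrite -[X in _ + X](@cabs1 R) le_cabsB.
  have pP : cabs (psi w) <= P w + K%:R by have := excess_ge (fun w => cabs (psi w)) K w; rewrite -/(P w); lra.
  have xd : x <= d + x ^+ 2 / d.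
    rewrite -(ler_pM2r d0) mulrDl divfK ?gt_eqF//.
    have := sqr_ge0 (x - d); have := mulr_ge0 x0 (ltW d0).
    by rewrite sqrrB !expr2 mulr2n; lra.
  apply: (@le_trans _ _ ((P w + K%:R) * x)); first by rewrite ler_wpM2r.
  rewrite mulrDl; apply: lerD; first by rewrite ler_wpM2l.
  have -> : K%:R * d + K%:R / d * x ^+ 2 = K%:R * (d + x ^+ 2 / d) by ring.
  by rewrite ler_wpM2l.
have lim1 : avg (fun w => P w * (cabs (v m w) + 1)) @[m --> \oo] --> avg (fun w => P w * (expR (- E w) + 1)).
  apply: (avg_dominated (g := fun w => (M + 1) * P w) _ _ _ _ _).2.
  - by move=> m; exact: intT_meas.
  - by apply: measRM => //; apply: measRD => //; exact: measR_cst.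
  - exact: intTZ.
  - by apply: ae_circleS vlim => w h; apply: cvgMr; apply: cvgD => //; exact: cvg_cst.
  - move=> m; apply: ae_circleS (vM m) => w h.
    rewrite normrM (ger0_norm (P0 w)) ger0_norm ?addr_ge0 ?cabs_ge0//.
    by rewrite mulrC ler_wpM2r// lerD2r.
have lim2 : avg (fun w => cabs (v m w) ^+ 2) @[m --> \oo] --> avg (fun w => expR (- E w) ^+ 2).
  apply: (avg_dominated (g := fun=> M ^+ 2) _ _ _ _ _).2.
  - by move=> m; exact: intT_meas.
  - exact: measRX.
  - exact: intT_cst.
  - by apply: ae_circleS vlim => w h; rewrite expr2; under eq_fun do rewrite expr2; exact: cvgM.
  - by move=> m; apply: ae_circleS (vM m) => w h; rewrite ger0_norm ?sqr_ge0// lerXn2r// nnegrE cabs_ge0.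
have iE1 : intT (fun w => P w * (expR (- E w) + 1)).
  apply: (le_intT _ (intTZ 2 iP)); first by apply: measRM => //; apply: measRD => //; exact: measR_cst.
  apply: ae_circleW => w; rewrite normrM (ger0_norm (P0 w)) ger0_norm ?addr_ge0 ?expR_ge0//.
  by rewrite mulrC ler_wpM2r//; have := E0 w; lra.
have iE2 : intT (fun w => expR (- E w) ^+ 2).
  apply: (intT_bdd (M := 1)); first exact: measRX.
  by apply: ae_circleW => w; rewrite ger0_norm ?sqr_ge0// expr_le1 ?expR_ge0.
apply: le_trans (cvg_ge_cst bound (cvgD lim1 (cvgD (cvg_cst _)
  (cvgMr (cvgD (cvgB lim2 (cvg_cst _)) (cvg_cst _)))))) _.
apply: lerD.
  rewrite -avgZ//; apply: le_avg => //; first exact: intTZ.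
  by move=> w; rewrite mulrC ler_wpM2r//; have := E0 w; lra.
apply: lerD => //; apply: ler_wpM2l; first by rewrite divr_ge0// ltW.
have : avg (fun w => expR (- E w) ^+ 2) <= 1.
  rewrite -(avg_cst 1); apply: le_avg => //; first exact: intT_cst.
  by move=> w; rewrite expr_le1 ?expR_ge0.
have := expR_ge1Dx (- avg E); rewrite -/E; lra.
Qed.

(** In [outer_cyclic_estimate] choose K to make the first term small, then d,
    then n. *)
Theorem outer_cyclic c k Go psi (B : R) :
  cabs c = 1 -> intT k -> boundary_function (outer_disc c k) Go ->
  ae_circle (fun w => k w <= B) -> L1 psi ->
  (forall q, Hinfty q -> integralT (fun w => psi w * (Go w * q w)) = 0) ->
  integralT psi = 0.
Proof.
move=> c1 ik bG kB psi1 hpsi; apply: cabs_le_eps => e e0.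
have e3 : 0 < e / 6 by rewrite divr_gt0.
have /cvgrPdist_le/(_ _ e3)[K _ /(_ K (leqnn K)) /=] := cvg_avg_excess (L1_cabs psi1).
rewrite sub0r normrN ger0_norm; last by apply: avg_ge0 => w; exact: excess_ge0.
move=> hK; pose d := e / (3 * (1 + K%:R)).
have K1 : 0 < 1 + K%:R :> R by rewrite ltr_pwDl.
have d0 : 0 < d by rewrite divr_gt0// mulr_gt0.
have Kd : K%:R * d <= e / 3.
  rewrite /d mulrA ler_pdivrMr ?mulr_gt0//.
  have -> : e / 3 * (3 * (1 + K%:R)) = e * (1 + K%:R) by field.
  by rewrite mulrC ler_wpM2l ?(ltW e0)// lerDr.
have a0 : 0 < e / 6 / (1 + K%:R / d) by rewrite divr_gt0// ltr_pwDl// divr_ge0// ltW.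
have /cvgrPdist_le/(_ _ a0)[n _ /(_ n (leqnn n)) /=] := cvg_avg_excess (intTN ik).
rewrite sub0r normrN ger0_norm; last by apply: avg_ge0 => w; exact: excess_ge0.
move=> hn; have := outer_cyclic_estimate n K c1 ik bG kB psi1 d0 hpsi.
move/le_trans; apply.
have Kd0 : 0 <= K%:R / d by rewrite divr_ge0// ltW.
have : K%:R / d * avg (excess (fun w => - k w) n) <= e / 6.
  apply: (le_trans (ler_wpM2l Kd0 hn)).
  rewrite mulrCA ler_piMr//; first exact: ltW.
  by rewrite ler_pdivrMr ?ltr_pwDl// mul1r lerDr.
move: hK Kd; lra.
Qed.

End Cyclicity.

(** * Kernels of paired and Toeplitz operators *)

Section Main.
Context {R : realType}.
Local Notation C := R[i].
Local Notation T := (circle R).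
Implicit Types (f g h theta G : T -> C).

(** The difference of two projections is in H^2 and orthogonal to itself. *)
Lemma Pplus_unique f g1 g2 : Pplus f g1 -> Pplus f g2 -> ae_eqT g1 g2.
Proof.
move=> [h1 [l1 o1]] [h2 [l2 o2]].
have hd : H2 (fun w => g1 w - g2 w) by exact: H2B.
have := inner_prodBl l2 l1 (H2_L2 hd); rewrite (o1 _ hd) (o2 _ hd) subrr.
rewrite (_ : (fun w => (f \- g2) w - (f \- g1) w) = fun w => g1 w - g2 w); last first.
  by apply/funext => w /=; ring.
move=> /(inner_prod_self0 (H2_L2 hd)); apply: ae_circleS => w /eqP.
by rewrite subr_eq0 => /eqP.
Qed.

Lemma Pplus_split f g : H2 f -> ominus L2 H2 g -> Pplus (fun w => f w + g w) f.
Proof.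
move=> hf hg; split=> //; rewrite (_ : _ \- _ = g)//.
by apply/funext => w /=; rewrite addrAC subrr add0r.
Qed.

Lemma ominus_ae f g : measurableT f -> ae_eqT f g -> ominus L2 H2 g -> ominus L2 H2 f.
Proof.
move=> mf fg [g2 og]; have /L2P[mg ig] := g2; split.
  by apply: (le_L2 mf ig); apply: ae_circleS fg => w ->.
by move=> h hh; rewrite (eq_inner_prod mf mg _ fg) ?og//; case: (H2_L2 hh).
Qed.

Lemma ominusN f : ominus L2 H2 f -> ominus L2 H2 (fun w => - f w).
Proof.
move=> [f2 of_]; split; first exact: L2N.
by move=> g hg; rewrite inner_prodNl ?of_ ?oppr0//; exact: H2_L2.
Qed.

(** The two projections are merged into one: P^- f is f - P^+ f, up to the
    uniqueness of P^+ f. *)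
Lemma ker_pairedP G f : ker_paired G f <->
  L2 f /\ exists2 fp, Pplus f fp & ae_eqT (fun w => G w * fp w) (fun w => fp w - f w).
Proof.
split=> [[f2 [fp [fm [Pp [fp' Pp' Em] E0]]]]|[f2 [fp Pp E]]].
- split=> //; exists fp => //; have U := Pplus_unique Pp Pp'.
  apply: ae_circleS3 U Em E0 => w /= <- -> e0.
  have -> : G w * fp w = (G w * fp w + (f w - fp w)) + (fp w - f w) by ring.
  by rewrite -e0 add0r.
- split=> //; exists fp, (fun w => f w - fp w); split=> //.
    by exists fp => //; exact: ae_circleW.
  by apply: ae_circleS E => w /= ->; ring.
Qed.

Lemma ker_toeplitzP G f : Linfty G ->
  ker_toeplitz G f <-> H2 f /\ ominus L2 H2 (fun w => G w * f w).
Proof.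
move=> G8; have E : (G \* f) \- (fun=> 0) = fun w => G w * f w.
  by apply/funext => w /=; rewrite subr0.
split=> [[hf [h0]]|[hf o]]; first by rewrite E.
split; first exact: hf.
by split; [exact: (Hinfty_H2 (@Hinfty_cst R 0))|rewrite E].
Qed.

(** A function g of ker T_G is the P^+ part of g - G g. *)
Lemma image_ker_paired G : Linfty G -> image_graph Pplus (ker_paired G) = ker_toeplitz G.
Proof.
move=> G8; have [mG [M GM]] := G8; apply/seteqP; split=> g.
- move=> [f /ker_pairedP[f2 [fp Pp E]] Pg]; apply/ker_toeplitzP => //.
  have [hg og] := Pg; split=> //; apply: (ominus_ae _ _ (ominusN og)).
    by apply: measurableTM => //; case: (H2_L2 hg).
  by apply: ae_circleS2 (Pplus_unique Pg Pp) E => w /= -> ->; ring.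
- move=> /(ker_toeplitzP _ G8)[hg og].
  exists (fun w => g w + - (G w * g w)); last by apply: Pplus_split => //; exact: ominusN.
  apply/ker_pairedP; split; first by apply: L2B; [exact: H2_L2|exact: og.1].
  exists g; first by apply: Pplus_split => //; exact: ominusN.
  by apply: ae_circleW => w; ring.
Qed.

Lemma inner_Hinfty theta : inner_function theta -> Hinfty theta. Proof. by case. Qed.

(** The factor is h = - conj (z f_-), where f_- = - G theta. *)
Lemma Hinfty_factor theta G fm : inner_function theta -> Linfty G ->
  H2minus fm -> ker_paired G (theta \+ fm) ->
  exists2 h, Hinfty h &
     ae_eqT (fun w => (G w)^*) (fun w => zfun w * theta w * h w).
Proof.
move=> [th8 th1] [mG [M GM]] ofm /ker_pairedP[_ [fp Pp E]].
have [l2 o2] := ofm; have mfm : measurableT fm by case: l2.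
have U := Pplus_unique Pp (Pplus_split (Hinfty_H2 th8) ofm).
have Gth : ae_circle (fun w => G w * theta w = - fm w).
  by apply: ae_circleS2 U E => w -> /= ->; ring.
pose h w := - (zfun w)^* * (fm w)^* : C.
have mh : measurableT h.
  apply: measurableTM; last exact: measurableTJ.
  by apply: measurableTN; apply: measurableTJ; exact: measurableT_zfun.
exists h.
- apply: Hinfty_of_moments.
    split=> //; exists M; apply: ae_circleS3 Gth GM th1 => w e GwM t1.
    have : cabs (G w * theta w) = cabs (fm w) by rewrite e cabsN.
    by rewrite cabsM t1 mulr1 /h mulNr cabsN cabsM !cabsJ /zfun cabs_circle mul1r => <-.
  case=> // j _; rewrite (_ : (fun w => _) = fun w => - ((val w ^+ j) * (fm w)^*)); last first.
    apply/funext => w; rewrite /h exprSr mulNr mulrN; congr (- _).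
    by rewrite -!mulrA [_ * (_ * (fm w)^*)]mulrA mulcJ cabs_circle expr1n mul1r.
  have hj : H2 (fun w : T => val w ^+ j) by apply: Hinfty_H2; apply: HinftyX; exact: Hinfty_zfun.
  rewrite integralTN; last by apply: L2M; [exact: H2_L2|exact: L2J].
  have := inner_prodC l2 (H2_L2 hj); rewrite (o2 _ hj) conjC0 => z.
  by apply/eqP; rewrite oppr_eq0; apply/eqP; exact: z.
- apply: ae_circleS2 Gth th1 => w e t1.
  have tn : theta w * (theta w)^* = 1 by rewrite mulcJ t1 expr1n.
  have zn : zfun w * (zfun w)^* = 1 :> C by rewrite mulcJ /zfun cabs_circle expr1n.
  have := congr1 Num.conj e; rewrite /= conjcM conjcN => ce.
  have -> : (G w)^* = (G w)^* * (theta w)^* * theta w by rewrite -mulrA [_ * theta w]mulrC tn mulr1.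
  rewrite ce /h; transitivity (zfun w * (zfun w)^* * (- (fm w)^* * theta w)); last by ring.
  by rewrite zn mul1r.
Qed.

(** A bound of the modulus exp k on the circle is a bound above of k, which the
    Poisson integral inherits in the disc. *)
Lemma Linfty_outer_Hinfty Go : Linfty Go -> outer_function Go ->
  exists c (k : T -> R) (B : R), [/\ cabs c = 1, intT k, boundary_function (outer_disc c k) Go,
    ae_circle (fun w => k w <= B) & Hinfty Go].
Proof.
move=> Go8 [c [k [c1 ik bG]]]; have [_ [M GM]] := Go8.
(* the logarithm needs a positive bound *)
exists c, k, (ln (`|M| + 1)).
have kB : ae_circle (fun w => k w <= ln (`|M| + 1)).
  apply: ae_circleS2 (cabs_outer_boundary c1 ik bG) GM => w -> kM.
  rewrite -ler_expR lnK ?posrE ?ltr_wpDl// (le_trans kM)// (le_trans (ler_norm _))// lerDl//.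
split=> //; split=> //; exists (outer_disc c k) => //.
exact: Hinfty_outer_disc kB.
Qed.

(** <G f, h> = <f, b Go h>, so the two spaces are the orthogonal complements of
    b Go H^2 and of b H^2. To pass from the first one to the second, apply
    [outer_cyclic] to psi = conj f * b h, with the tests q h in H^2. *)
Lemma ker_toeplitz_model G b Go : Linfty G -> Hinfty b ->
  ae_circle (fun w => cabs (b w) = 1) -> outer_function Go ->
  ae_eqT (fun w => (G w)^*) (fun w => b w * Go w) ->
  ker_toeplitz G = model_space b.
Proof.
move=> G8 b8 b1 oG Gb; have [mG [M GM]] := G8.
have mGo : measurableT Go by case: oG => c [k [_ _ []]].
have mb : measurableT b := b8.1.1.
have Go8 : Linfty Go.
  split=> //; exists M; apply: ae_circleS3 Gb b1 GM => w e u1 gM.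
  by rewrite -[cabs (Go w)]mul1r -u1 -cabsM -e cabsJ.
have [c [k [B [c1 ik bG kB GoH]]]] := Linfty_outer_Hinfty Go8 oG.
have adj f h : H2 f -> H2 h ->
    inner_prod (fun w => G w * f w) h = inner_prod f (fun w => b w * (Go w * h w)).
  move=> hf hh; have mf := (H2_L2 hf).1; have mh := (H2_L2 hh).1.
  apply: eq_integralT_ae.
  - by apply: measurableTM; [exact: measurableTM|exact: measurableTJ].
  - by apply: measurableTM => //; apply: measurableTJ; apply: measurableTM => //; exact: measurableTM.
  - apply: ae_circleS Gb => w e; have := congr1 Num.conj e; rewrite conjCK /= => ->.
    by rewrite !conjcM; ring.
apply/seteqP; split=> f.
- move=> /(ker_toeplitzP _ G8)[hf [_ of_]]; split=> // _ [h hh <-].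
  have mf := (H2_L2 hf).1.
  have hbh : H2 (fun w => b w * h w) by exact: H2M.
  pose psi w := (f w)^* * (b w * h w).
  have psi1 : L1 psi by apply: L2M; [apply: L2J; exact: H2_L2|exact: H2_L2].
  have psi0 : integralT psi = 0.
    apply: (outer_cyclic c1 ik bG kB psi1) => q hq.
    have hqh : H2 (fun w => q w * h w) by exact: H2M.
    have := of_ _ hqh; rewrite adj// => /(congr1 Num.conj).
    have h3 : H2 (fun w => b w * (Go w * (q w * h w))) by exact: (H2M b8 (H2M GoH hqh)).
    rewrite -inner_prodC; [|exact: H2_L2..].
    rewrite conjC0 => <-; congr integralT; apply/funext => w; rewrite /psi; ring.
  have E : inner_prod (fun w => b w * h w) f = integralT psi.
    by congr integralT; apply/funext => w; rewrite /psi mulrC.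
  by have := inner_prodC (H2_L2 hbh) (H2_L2 hf); rewrite E psi0 conjC0.
- move=> [hf of_]; apply/ker_toeplitzP => //; split=> //; split.
    exact: L2_bddM (H2_L2 hf) mG GM.
  move=> h hh; rewrite (adj f h hf hh); apply: of_.
  by exists (fun w => Go w * h w); first exact: (H2M GoH hh).
Qed.

End Main.

Theorem proposition2p2 (R : realType) (theta G : circle R -> R[i]) :
  inner_function theta -> Linfty G -> ~ ae_eqT G (fun=> 0) ->
  (exists2 fm, H2minus fm & ker_paired G (theta \+ fm)) ->
  (exists2 h, Hinfty h &
     ae_eqT (fun w => (G w)^*) (fun w => zfun w * theta w * h w)) /\
  (forall Gi Go : circle R -> R[i],
     inner_function Gi -> outer_function Go ->
     ae_eqT (fun w => (G w)^*) (fun w => theta w * zfun w * Gi w * Go w) ->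
     image_graph Pplus (ker_paired G) = ker_toeplitz G /\
     ker_toeplitz G = model_space (fun w => zfun w * theta w * Gi w)).
Proof.
move=> thi G8 _ [fm ofm kfm]; split; first exact: Hinfty_factor kfm.
move=> Gi Go Gii oGo GE; split; first exact: image_ker_paired.
apply: (ker_toeplitz_model G8 _ _ oGo).
- apply: HinftyM; last exact: inner_Hinfty.
  by apply: HinftyM; [exact: Hinfty_zfun|exact: inner_Hinfty].
- apply: ae_circleS2 thi.2 Gii.2 => w t1 g1.
  by rewrite !cabsM t1 g1 /zfun cabs_circle !mulr1.
- by apply: ae_circleS GE => w ->; ring.
Qed.
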